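(* Let $\mathcal{P}_\Sigma$ be the class of distributions on $\mathbb{R}^d\times\{0,1\}$ defined in the context, and let $C_1,C_2$ be the constants of the estimation bound recalled in the context. There exist constants $C,B>0$, which depend only on $\alpha,p,d,C_0,C_1,C_2$, such that for any $n>1$, $N>1$, $$\inf_{\hat g}\ \sup_{\mathbb{P}\in\mathcal{P}_\Sigma}\mathbb{E}_{(\mathcal{D}_n,\mathcal{D}_N)}\,\mathcal{E}_1(\hat g)\le C\,n^{-\frac{(1+\alpha)\beta}{2\beta+d}},$$ $$\inf_{\hat\theta}\ \sup_{\mathbb{P}\in\mathcal{P}_\Sigma}\mathbb{E}_{(\mathcal{D}_n,\mathcal{D}_N)}\,|\theta^*-\hat\theta|\le B\,n^{-\frac{\beta}{2\beta+d}},$$ where the infima are taken over all estimators $\hat g$ and $\hat\theta$ (constructed from $(\mathcal{D}_n,\mathcal{D}_N)$), respectively.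
   Context: Setting: $(X,Y)\sim\mathbb{P}$ on $\mathbb{R}^d\times\{0,1\}$, $\mathbb{P}_X$ is the marginal law of $X$, and $\eta(x)=\mathbb{P}(Y=1\mid X=x)$. $\mathcal{D}_n$ consists of $n$ i.i.d. copies of $(X,Y)$ (law $\mathbb{P}^{\otimes n}$). $\mathcal{D}_N$ consists of $N$ i.i.d. copies of $X$, independent of $\mathcal{D}_n$. $\mathbb{E}_{(\mathcal{D}_n,\mathcal{D}_N)}$ is expectation under $\mathbb{P}^{\otimes n}\otimes\mathbb{P}_X^{\otimes N}$. For a classifier (measurable) $g:\mathbb{R}^d\to\{0,1\}$, $F_1(g)=\frac{\mathbb{P}(Y=1,g(X)=1)}{\mathbb{P}(Y=1)+\mathbb{P}(g(X)=1)}$ and $\mathcal{E}_1(g)=F_1(g^* )-F_1(g)$, where $g^*$ is a maximizer of $F_1$ over all classifiers. The optimal threshold $\theta^*=\theta^*(\mathbb{P})\in[0,1]$ is the unique root of $\theta\,\mathbb{P}(Y=1)=\mathbb{E}(\eta(X)-\theta)_+$, where $(u)_+=\max(u,0)$. Hölder class: $\Sigma(\beta,L,\mathbb{R}^d)$ is the set of functions $h:\mathbb{R}^d\to[0,1]$ such that $|h(x')-h_x(x')|\le L\|x-x'\|_2^\beta$ for all $x,x'\in\mathbb{R}^d$, where $h_x$ is the Taylor polynomial of $h$ at $x$ of degree $\lfloor\beta\rfloor$. A Lebesgue measurable set $A\subset\mathbb{R}^d$ is $(c_0,r_0)$-regular if $\lambda(A\cap\mathcal{B}(x,r))\ge c_0\lambda(\mathcal{B}(x,r))$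 for every $x\in A$ and $r\in(0,r_0]$, where $\lambda$ is Lebesgue measure and $\mathcal{B}(x,r)$ is the Euclidean ball of radius $r$ centered at $x$. The class $\mathcal{P}_\Sigma$ (for constants $\alpha,C_0,p,\beta,L,c_0,r_0,\mu_{\min},\mu_{\max}>0$ and $\delta_0\in(0,1/12]$, not depending on $n,N$) consists of the distributions $\mathbb{P}$ on $\mathbb{R}^d\times\{0,1\}$ such that: (i) (margin) $\mathbb{P}_X(0<|\eta(X)-\theta^*|\le\delta)\le C_0\delta^\alpha$ for every positive $\delta\le\delta_0$; (ii) $\mathbb{P}(Y=1)\ge p$; (iii) $\eta\in\Sigma(\beta,L,\mathbb{R}^d)$; (iv) (strong density) $\mathbb{P}_X$ is supported on a compact $(c_0,r_0)$-regular set $A\subset\mathbb{R}^d$ and admits a density with respect to Lebesgue measure that is lower- and upper-bounded (on $A$) by $\mu_{\min}$ and $\mu_{\max}$. Estimation bound (Audibert and Tsybakov, 2007): under (iii) and (iv) there is an estimator $\hat\eta$ of $\eta$ based on $\mathcal{D}_n$ and constants $C_1,C_2>0$, depending on $\beta,d,L,c_0,r_0$, such that, uniformly over the distributions satisfying (iii) and (iv) and for all $t>0$, $\mathbb{P}^{\otimes n}(|\hat\eta(x)-\eta(x)|\ge t)\le C_1\exp(-C_2n^{\frac{2\beta}{2\beta+d}}t^2)$ for $\mathbb{P}_X$-almost every $x$.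
   Formalization: The constant C in the first bound is allowed to depend also on δ_0 (B is not); uniformity of C over δ_0 in (0,1/12] is false, since for δ_0 smaller than a multiple of n^{-β/(2β+d)} the margin condition can hold vacuously. *)

(* Defs.v *)
From HB Require Import structures.
From mathcomp Require Import all_boot all_order all_algebra.
From mathcomp Require Import all_classical all_reals all_analysis.

Set Implicit Arguments.
Unset Strict Implicit.
Unset Printing Implicit Defensive.

Import Order.TTheory GRing.Theory Num.Theory.
Import numFieldNormedType.Exports.

Local Open Scope classical_set_scope.
Local Open Scope ring_scope.

(* R^d is 'rV[R]_d and the labels {0,1} are bool. The sigma-algebra on        *)
(* 'rV[R]_d is the one generated by the coordinates, as for n.-tuple in the   *)
(* library; it is the Borel sigma-algebra of R^d.                             *)
Section measurable_rV.
Context {R : realType} (d : nat).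

Let coord_rV : 'I_d -> 'rV[R]_d -> R := fun i x => x ord0 i.

Let rV_set0 : g_sigma_preimage coord_rV set0.
Proof. exact: sigma_algebra0. Qed.

Let rV_setC A : g_sigma_preimage coord_rV A -> g_sigma_preimage coord_rV (~` A).
Proof. exact: sigma_algebraC. Qed.

Let rV_bigcup (F : _^nat) : (forall i, g_sigma_preimage coord_rV (F i)) ->
  g_sigma_preimage coord_rV (\bigcup_i (F i)).
Proof. exact: sigma_algebra_bigcup. Qed.

HB.instance Definition _ :=
  @isMeasurable.Build (measure_tuple_display default_measure_display)
    'rV[R]_d (g_sigma_preimage coord_rV) rV_set0 rV_setC rV_bigcup.

Lemma measurable_fun_rVP d1 (T : measurableType d1) (f : T -> 'rV[R]_d) :
  (forall i, measurable_fun setT (fun t => f t ord0 i)) ->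
  measurable_fun setT f.
Proof.
move=> mf; apply: (@measurability _ _ _ _ _ _
  (\big[setU/set0]_(i < d) preimage_set_system setT (coord_rV i) measurable)) => //.
move=> _ [B + <-].
rewrite -bigcup_seq => -[i _ [A mA <-]]; rewrite !setTI.
by have := mf i measurableT _ mA; rewrite setTI.
Qed.

End measurable_rV.

Section power_measure.
Context d (T : measurableType d) (R : realType).

Section cons.
Variables (n : nat) (m1 : {sigma_finite_measure set T -> \bar R}).
Variable m2 : {sigma_finite_measure set (n.-tuple T) -> \bar R}.

Definition consp (x : T * n.-tuple T) : n.+1.-tuple T := [tuple of x.1 :: x.2].

Lemma measurable_consp : measurable_fun setT consp.
Proof. exact: measurable_cons. Qed.

Definition cons_measure : set (n.+1.-tuple T) -> \bar R :=
  pushforward (m1 \x m2)%E consp.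

Let cons_measure0 : cons_measure set0 = 0%E.
Proof. by rewrite /cons_measure /pushforward preimage_set0 measure0. Qed.

Let cons_measure_ge0 A : (0 <= cons_measure A)%E.
Proof. by rewrite /cons_measure /pushforward measure_ge0. Qed.

Let cons_measure_sigma_additive : semi_sigma_additive cons_measure.
Proof.
exact: (@measure_semi_sigma_additive _ _ _
  (measure_function_pushforward__canonical__measure_function_Measure
     (m1 \x m2)%E measurable_consp)).
Qed.

HB.instance Definition _ := isMeasure.Build _ _ _ cons_measure
  cons_measure0 cons_measure_ge0 cons_measure_sigma_additive.

Let cons_measure_sigma_finite : sigma_finite setT cons_measure.
Proof.
have /sigma_finiteP[F [TF ndF Foo]] := sigma_finiteT m1.
have /sigma_finiteP[G [TG ndG Goo]] := sigma_finiteT m2.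
pose g (t : n.+1.-tuple T) := (thead t, [tuple of behead t]).
have gK : cancel consp g by case=> x t; congr pair; apply/val_inj.
have mg : measurable_fun setT g.
  by apply/measurable_fun_pair; [exact: measurable_tnth|exact: measurable_behead].
exists (fun k => g @^-1` (F k `*` G k)).
  apply/esym; rewrite -subTset => t _.
  have [i _ Fi] : (\bigcup_i F i) (thead t) by rewrite -TF.
  have [j _ Gj] : (\bigcup_i G i) [tuple of behead t] by rewrite -TG.
  exists (maxn i j) => //; split.
    exact: (elimT (subsetPset _ _) (ndF _ _ (leq_maxl i j))).
  exact: (elimT (subsetPset _ _) (ndG _ _ (leq_maxr i j))).
move=> k; have [mF oF] := Foo k; have [mG oG] := Goo k; split.
  by rewrite -[X in measurable X]setTI; apply: mg => //; exact: measurableX.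
rewrite /cons_measure /pushforward -comp_preimage.
rewrite (_ : g \o consp = id); last by apply/funext => x /=; rewrite gK.
by rewrite product_measure1E// lte_mul_pinfty// ge0_fin_numE.
Qed.

HB.instance Definition _ := Measure_isSigmaFinite.Build _ _ _ cons_measure
  cons_measure_sigma_finite.

End cons.

Definition nil_measure : set (0.-tuple T) -> \bar R := \d_([tuple] : 0.-tuple T).

HB.instance Definition _ := Measure.on nil_measure.

Let nil_measure_setT : nil_measure setT = 1%E. Proof. exact: diracT. Qed.

HB.instance Definition _ :=
  Measure_isProbability.Build _ _ _ nil_measure nil_measure_setT.

(* The n-fold product measure, on n-tuples. *)
Fixpoint power_measure (m : {sigma_finite_measure set T -> \bar R}) (n : nat) :
    {sigma_finite_measure set (n.-tuple T) -> \bar R} :=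
  if n is n'.+1 then cons_measure m (power_measure m n') else nil_measure.

Lemma power_measure_setT (P : probability T R) n :
  power_measure P n setT = 1%E.
Proof.
elim: n => [|n IH] /=; first exact: probability_setT.
rewrite /cons_measure /pushforward preimage_setT -setXTT.
by rewrite product_measure1E// IH mule1; exact: probability_setT.
Qed.

Definition iid (P : probability T R) (n : nat) : set (n.-tuple T) -> \bar R :=
  power_measure P n.
Arguments iid P n : clear implicits.

HB.instance Definition _ P n := SigmaFiniteMeasure.on (iid P n).
HB.instance Definition _ P n := Measure_isProbability.Build _ _ _ (iid P n)
  (power_measure_setT P n).
End power_measure.
Arguments iid {d T R} P n.

Section euclidean_space.
Context {R : realType} (d : nat).
Implicit Types (x y : 'rV[R]_d) (A : set 'rV[R]_d) (h : 'rV[R]_d -> R).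

Definition norm2 x : R := Num.sqrt (\sum_(i < d) x ord0 i ^+ 2).

Definition ball2 x (r : R) : set 'rV[R]_d := [set y | norm2 (y - x) <= r].

Definition row_of_tuple (t : d.-tuple (measurableTypeR R)) : 'rV[R]_d :=
  \row_i tnth t i.

Lemma measurable_row_of_tuple : measurable_fun setT row_of_tuple.
Proof.
apply: measurable_fun_rVP => i.
under eq_fun do rewrite mxE.
exact: measurable_tnth.
Qed.

HB.instance Definition _ := isMeasurableFun.Build _ _ _ _ row_of_tuple
  measurable_row_of_tuple.

Definition lebesgue_rV : set 'rV[R]_d -> \bar R :=
  pushforward (power_measure (@lebesgue_measure R) d) row_of_tuple.

Let lebesgue_rV0 : lebesgue_rV set0 = 0%E.
Proof. by rewrite /lebesgue_rV /pushforward preimage_set0 measure0. Qed.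

Let lebesgue_rV_ge0 A : (0 <= lebesgue_rV A)%E.
Proof. by rewrite /lebesgue_rV /pushforward measure_ge0. Qed.

Let lebesgue_rV_sigma_additive : semi_sigma_additive lebesgue_rV.
Proof.
exact: (@measure_semi_sigma_additive _ _ _
  (measure_function_pushforward__canonical__measure_function_Measure
     (power_measure (@lebesgue_measure R) d) measurable_row_of_tuple)).
Qed.

HB.instance Definition _ := isMeasure.Build _ _ _ lebesgue_rV
  lebesgue_rV0 lebesgue_rV_ge0 lebesgue_rV_sigma_additive.

Definition regular_set (c0 r0 : R) A :=
  forall x r, A x -> 0 < r <= r0 ->
    (c0%:E * lebesgue_rV (ball2 x r) <= lebesgue_rV (A `&` ball2 x r))%E.

(* partials [:: i_1; ...; i_j] h = d_{i_1} ... d_{i_j} h *)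
Definition partial (i : 'I_d) h : 'rV[R]_d -> R :=
  fun x => 'D_(delta_mx ord0 i) h x.

Definition partials (s : seq 'I_d) h : 'rV[R]_d -> R := foldr partial h s.

Definition class_C (k : nat) h :=
  (forall s : seq 'I_d, (size s <= k)%N -> continuous (partials s h)) /\
  (forall (s : seq 'I_d) i x, (size s < k)%N ->
    derivable (partials s h) x (delta_mx ord0 i)).

(* The homogeneous part of degree j is D^j h(x)[y - x, ..., y - x] / j!,      *)
(* expanded along the canonical basis.                                        *)
Definition taylor (k : nat) h x y : R :=
  \sum_(j < k.+1) (j`!%:R)^-1 *
    \sum_(s : j.-tuple 'I_d) partials s h x * \prod_(i <- s) (y - x) ord0 i.

(* Num.truncn beta is the integer part of beta, for beta >= 0. *)
Definition holder (beta L : R) h :=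
  [/\ forall x, 0 <= h x <= 1,
      class_C (Num.truncn beta) h
    & forall x y, `|h y - taylor (Num.truncn beta) h x y|
                    <= L * norm2 (x - y) `^ beta].

(* Q is carried by A, with density f with respect to Lebesgue measure. *)
Definition strong_density (c0 r0 mumin mumax : R) (Q : set 'rV[R]_d -> \bar R) :=
  exists A (f : 'rV[R]_d -> R),
    [/\ compact A, regular_set c0 r0 A & Q (~` A) = 0%E] /\
    [/\ measurable_fun setT f, forall x, 0 <= f x,
        forall B, measurable B -> Q B = (\int[lebesgue_rV]_(x in B) (f x)%:E)%E
      & forall x, A x -> mumin <= f x <= mumax].

End euclidean_space.

Section classification.
Context {R : realType} (d : nat).
Local Notation point := 'rV[R]_d.
Local Notation obs := ('rV[R]_d * bool)%type.
Implicit Types (P : probability obs R) (eta : point -> R) (g : point -> bool).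

HB.instance Definition _ := isMeasurableFun.Build _ _ _ _
  (fst : obs -> point) measurable_fst.

Definition marginal P : probability point R :=
  distribution P (fst : {mfun obs >-> point}).

Definition prob1 P : R := fine (P [set z : obs | z.2]).

(* eta is a version of x |-> P(Y = 1 | X = x). *)
Definition regression P eta :=
  [/\ measurable_fun setT eta, forall x, 0 <= eta x <= 1
    & forall B, measurable B ->
        P (B `*` [set true]) = (\int[marginal P]_(x in B) (eta x)%:E)%E].

(* All versions eta give the same equation, whose root is unique as soon as   *)
(* P(Y = 1) > 0; the default value of xget below is then irrelevant.          *)
Definition is_theta_star P (theta : R) :=
  0 <= theta <= 1 /\
  exists2 eta, regression P eta &
    (theta * prob1 P)%:E
      = (\int[marginal P]_x (Num.max (eta x - theta) 0)%:E)%E.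

Definition theta_star P : R := xget 0 [set theta | is_theta_star P theta].

Definition F1 P g : R :=
  fine (P [set z : obs | z.2 && g z.1]) / (prob1 P + fine (P [set z : obs | g z.1])).

Definition classifier g := measurable_fun setT g.

(* A maximizer of F1 over all classifiers. *)
Definition g_star P : point -> bool :=
  xget (cst false) [set g | classifier g /\
                            forall g', classifier g' -> F1 P g' <= F1 P g].

Definition excess P g : R := F1 P (g_star P) - F1 P g.

Definition margin (alpha C0 delta0 : R) P eta :=
  forall delta, 0 < delta <= delta0 ->
    (marginal P [set x | 0 < `|eta x - theta_star P| <= delta]%R
       <= (C0 * delta `^ alpha)%:E)%E.

Definition P_Sigma (alpha C0 delta0 p beta L c0 r0 mumin mumax : R)
    : set (probability obs R) :=
  [set P | exists eta,
    [/\ regression P eta, margin alpha C0 delta0 P eta, p <= prob1 P,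
        holder beta L eta & strong_density c0 r0 mumin mumax (marginal P)]].

(* The estimator may depend on n and on all the parameters of the class, but  *)
(* neither on P nor on t.                                                     *)
Definition estimation_bound (beta L c0 r0 mumin mumax C1 C2 : R) :=
  forall n, (0 < n)%N ->
  exists etahat : n.-tuple obs * point -> R,
    measurable_fun setT etahat /\
    forall P eta, regression P eta -> holder beta L eta ->
      strong_density c0 r0 mumin mumax (marginal P) ->
      forall t : R, 0 < t ->
        {ae marginal P, forall x,
          (iid P n [set D | t <= `|etahat (D, x) - eta x|]%R <=
           (C1 * expR (- (C2 * n%:R `^ (2 * beta / (2 * beta + d%:R)) * t ^+ 2)))%:E)%E}.

Definition sample_law P n N : set (n.-tuple obs * N.-tuple point) -> \bar R :=
  (iid P n \x iid (marginal P) N)%E.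
Arguments sample_law P n N : clear implicits.

HB.instance Definition _ P n N := Probability.on (sample_law P n N).

(* An estimator is a measurable map of the data (and, for ghat, jointly of    *)
(* the data and of the point to be classified).                               *)
Definition classifier_estimator n N
    (ghat : n.-tuple obs * N.-tuple point * point -> bool) :=
  measurable_fun setT ghat.

Definition threshold_estimator n N
    (thetahat : n.-tuple obs * N.-tuple point -> R) :=
  measurable_fun setT thetahat.

Definition classifier_risk P n N
    (ghat : n.-tuple obs * N.-tuple point * point -> bool) : \bar R :=
  (\int[sample_law P n N]_D (excess P (fun x => ghat (D, x)))%:E)%E.

Definition threshold_risk P n N
    (thetahat : n.-tuple obs * N.-tuple point -> R) : \bar R :=
  (\int[sample_law P n N]_D (`|theta_star P - thetahat D|)%:E)%E.

Definition minimax_classifier (S : set (probability obs R)) n N : \bar R :=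
  ereal_inf [set ereal_sup [set classifier_risk P ghat | P in S]
            | ghat in @classifier_estimator n N].

Definition minimax_threshold (S : set (probability obs R)) n N : \bar R :=
  ereal_inf [set ereal_sup [set threshold_risk P thetahat | P in S]
            | thetahat in @threshold_estimator n N].

End classification.

Arguments P_Sigma {R} d.
Arguments estimation_bound {R} d.

(* Main.v *)
(* The unlabeled sample is not needed: half of the labeled sample of size n    *)
(* gives the estimator etahat, and the other half, of size k, gives the root   *)
(* thetahat of theta * max(Ybar, p) = k^-1 * sum_i (etahat(X_i) - theta)_+,    *)
(* an empirical version of the equation of theta*. Its slope in theta is at    *)
(* least p, so that |thetahat - theta*| <= W / p where W is the empirical      *)
(* defect at the single point theta*; W is bounded by two centered means of    *)
(* [0,1]-valued i.i.d. variables (of order k^(-1/2), which is at most the      *)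
(* rate) and by the mean of |etahat - eta|(X_i), all whose moments are of the  *)
(* order of the rate since etahat is independent of the X_i.                   *)
(* Since F1(g_star) = theta*, the excess of the plug-in rule                   *)
(* thetahat < etahat x is at most p^-1 times the integral of |eta - theta*|    *)
(* over the set where the rule disagrees with theta* < eta, hence where        *)
(* |eta - theta*| <= |etahat - eta| + |thetahat - theta*|; the margin          *)
(* condition turns the two resulting terms into powers 1 + alpha of the rate.  *)

Require Import Defs.
From mathcomp Require Import all_boot all_order all_algebra.
From mathcomp Require Import all_classical all_reals all_analysis.
From mathcomp Require Import measurable_realfun.
From mathcomp Require Import zify ring lra.
Import Order.TTheory GRing.Theory Num.Theory.
Import numFieldNormedType.Exports.
Local Open Scope classical_set_scope.
Local Open Scope ring_scope.

Set Implicit Arguments.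
Unset Strict Implicit.
Unset Printing Implicit Defensive.

(** * Integrals against product measures *)

(** Every error is measured against [s], the rate m^(-beta / (2 beta + d)) of [etahat] computed on
    [m] observations. For almost every x the error V = |etahat - eta| at x has a Gaussian tail at
    scale [s], so its moment of order q is of order s^q ([moment_of_gauss_tail]).

    Threshold. The function theta P(Y = 1) - E(eta - theta)_+ increases with slope at least p, and
    its truncated empirical version keeps that slope. Two such roots are therefore no further apart
    than the empirical defect at [theta_star], divided by p ([emp_root_error]). The defect has three
    parts: two centered means, with moments of order k^(-q/2) by exponential moments
    ([iid_mean_moment]), and the mean of V over points independent of [etahat], treated by
    convexity. Since beta / (2 beta + d) is at most 1/2, all three are of order s^q, which is
    [theta_hat_moment].

    Classifier. [F1_gap] linearizes the F-score: [theta_star] minus F1 of g, times the denominator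
    of F1, is the integral of u = |eta - theta_star| over the set where g disagrees with the rule
    [theta_star < eta]. Hence the maximum of F1 is [theta_star], and the excess is at most this
    integral over p. Where the plug-in rule disagrees, u <= V + W with W the threshold error, so u
    <= 2V or u <= 2W. In the first case averaging over the sample gives u the weight exp(-c (u/s)^2
    / 8) up to a constant, and the margin condition integrates the product to order s^(1 + alpha)
    ([margin_gauss_le]). In the second case the integral is at most M (2W)^(1 + alpha), and the
    moment of order 1 + alpha of W concludes. *)

Lemma integral_prob_cst d (T : measurableType d) (R : realType)
    (P : probability T R) (c : \bar R) : (\int[P]_x c = c)%E.
Proof.
rewrite (integral_cst P measurableT c) [X in (_ * X)%E](_ : _ = 1%E) ?mule1//.
exact: probability_setT.
Qed.

Section iid_integrals.
Context d (T : measurableType d) (R : realType).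
Implicit Types (P : probability T R).

Lemma integral_iid0 P (f : 0.-tuple T -> \bar R) :
  measurable_fun setT f ->
  (\int[iid P 0]_t f t = f [tuple])%E.
Proof.
move=> mf.
by rewrite [LHS](@integral_dirac _ _ ([tuple] : 0.-tuple T) R setT)// diracT mul1e.
Qed.

Lemma integral_iidS P n (f : n.+1.-tuple T -> \bar R) :
  measurable_fun setT f -> (forall t, 0 <= f t)%E ->
  (\int[iid P n.+1]_t f t
   = \int[P]_x \int[iid P n]_t f (consp (x, t)))%E.
Proof.
move=> mf f0.
transitivity (\int[pushforward (P \x power_measure P n)%E (@consp _ T n)]_t f t)%E => //.
rewrite (ge0_integral_pushforward (@measurable_consp _ T n))//.
rewrite preimage_setT fubini_tonelli1 => [//||x /=]; last exact: f0.
by apply: measurableT_comp => //; exact: measurable_consp.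
Qed.

Definition catp m k (z : m.-tuple T * k.-tuple T) : (m + k).-tuple T :=
  [tuple of z.1 ++ z.2].

Lemma tnth_catp_lshift m k (z : m.-tuple T * k.-tuple T) i :
  tnth (catp z) (lshift k i) = tnth z.1 i.
Proof. by case: z => s t; rewrite /catp tnth_lshift. Qed.

Lemma tnth_catp_rshift m k (z : m.-tuple T * k.-tuple T) i :
  tnth (catp z) (rshift m i) = tnth z.2 i.
Proof. by case: z => s t; rewrite /catp tnth_rshift. Qed.

Lemma measurable_catp m k : measurable_fun setT (@catp m k).
Proof.
apply/measurable_fun_tnthP => i; case: (split_ordP i) => j ->; rewrite /comp.
  under eq_fun do rewrite tnth_catp_lshift.
  exact: (measurableT_comp (measurable_tnth j) measurable_fst).
under eq_fun do rewrite tnth_catp_rshift.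
exact: (measurableT_comp (measurable_tnth j) measurable_snd).
Qed.

Lemma catp_cons m k x (s : m.-tuple T) (t : k.-tuple T) :
  consp (x, catp (s, t)) = catp (consp (x, s), t).
Proof. exact/val_inj. Qed.

(** Independence of the two halves of a sample, on which sample splitting rests: once the first half
    is frozen, the second is still i.i.d. The induction peels coordinates off the first half. *)
Lemma integral_iidD P m k (f : (m + k).-tuple T -> \bar R) :
  measurable_fun setT f -> (forall t, 0 <= f t)%E ->
  (\int[iid P (m + k)]_t f t
   = \int[iid P m]_s \int[iid P k]_t f (catp (s, t)))%E.
Proof.
elim: m f => [|m IH] f mf f0.
  rewrite integral_iid0.
    apply: eq_integral => t _; congr f.
    by apply/val_inj.
  apply: (@measurable_fun_fubini_tonelli_F _ _ _ _ R (iid P k)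
    (fun z => f (catp z))) => //.
  by apply: measurableT_comp => //; exact: measurable_catp.
rewrite (@integral_iidS P (m + k))// integral_iidS.
- apply: eq_integral => x _.
  rewrite IH//.
    apply: eq_integral => s _; apply: eq_integral => t _.
    by rewrite catp_cons.
  apply: measurableT_comp => //.
  apply: (measurableT_comp (@measurable_consp _ T (m + k))).
  exact: pair1_measurable.
- apply: (@measurable_fun_fubini_tonelli_F _ _ _ _ R (iid P k)
    (fun z => f (catp z))) => //.
  by apply: measurableT_comp => //; exact: measurable_catp.
- by move=> t; apply: integral_ge0.
Qed.

Lemma integral_iid_tnth P n (i : 'I_n) (f : T -> \bar R) :
  measurable_fun setT f -> (forall x, 0 <= f x)%E ->
  (\int[iid P n]_t f (tnth t i) = \int[P]_x f x)%E.
Proof.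
move=> mf f0; elim: n i => [[]//|n IH i].
rewrite integral_iidS//; last first.
  by apply: measurableT_comp => //; exact: measurable_tnth.
have [j ->|->] := unliftP ord0 i.
  under eq_integral => x _.
    under eq_integral => t _ do rewrite tnthS.
    rewrite IH; over.
  by rewrite integral_prob_cst.
apply: eq_integral => x _; under eq_integral => t _ do rewrite tnth0.
exact: (integral_prob_cst (iid P n) (f x)).
Qed.

Lemma integral_iid_prod P n (f : T -> R) (c : R) :
  measurable_fun setT f -> (forall x, 0 <= f x) ->
  (\int[P]_x (f x)%:E = c%:E)%E ->
  (\int[iid P n]_t (\prod_(i < n) f (tnth t i))%:E = (c ^+ n)%:E)%E.
Proof.
move=> mf f0 fc; elim: n => [|n IH].
  by under eq_integral do rewrite big_ord0; rewrite integral_prob_cst.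
have mprod k : measurable_fun setT
    (fun t : k.-tuple T => (\prod_(i < k) f (tnth t i))%:E).
  apply: measurableT_comp => //; apply: measurable_prod => i _.
  by apply: measurableT_comp => //; exact: measurable_tnth.
rewrite integral_iidS//; last by move=> t; rewrite lee_fin prodr_ge0.
transitivity (\int[P]_x ((f x)%:E * (c ^+ n)%:E))%E.
  apply: eq_integral => x _.
  transitivity (\int[iid P n]_t
      ((f x)%:E * (\prod_(i < n) f (tnth t i))%:E))%E.
    apply: eq_integral => t _; rewrite big_ord_recl tnth0 EFinM.
    by congr (_ * _%:E)%E; apply: eq_bigr => i _; rewrite tnthS.
  rewrite ge0_integralZl_EFin ?IH//.
    by move=> t _; rewrite lee_fin prodr_ge0.
  exact: mprod.
have c0 : 0 <= c.
  by rewrite -lee_fin -fc; apply: integral_ge0 => ? _; rewrite lee_fin.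
rewrite exprS EFinM -fc; apply: ge0_integralZr => //.
- exact: measurableT_comp.
- by move=> x _; rewrite lee_fin.
- by rewrite lee_fin exprn_ge0.
Qed.

End iid_integrals.

(** * Moments of centered means *)

(** Squaring [1 - x / 2 <= expR (- (x / 2))] bounds [expR x] by the inverse of [(1 - x / 2) ^+ 2];
    the quadratic dominates this inverse because the product of the two polynomials exceeds 1 by x^2
    (1 - x) (5 - 2x) / 4. *)
Lemma expR_le_quadratic (R : realType) (x : R) :
  x <= 1 -> expR x <= 1 + x + 2 * x ^+ 2.
Proof.
move=> x1; have x2 : 0 < 1 - x / 2 by lra.
have : 1 - x / 2 <= expR (- (x / 2)) by exact: expR_ge1Dx.
rewrite -(@ler_pXn2r _ 2)// ?nnegrE ?(ltW x2) ?expR_ge0// -expRM_natr.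
rewrite (_ : - (x / 2) * 2%:R = - x); last by field.
move=> e2.
rewrite -(ler_pM2r (exprn_gt0 2 x2)).
apply: (@le_trans _ _ 1).
  by rewrite -[leRHS](expRxMexpNx_1 x) ler_wpM2l// expR_ge0.
have -> : (1 + x + 2 * x ^+ 2) * (1 - x / 2) ^+ 2
  = 1 + x ^+ 2 * ((1 - x) * (5 - 2 * x) / 4) by field.
by rewrite lerDl mulr_ge0 ?sqr_ge0// divr_ge0// mulr_ge0; lra.
Qed.

(** Apply [y <= expR y] to y = x / q and raise to the power q. It reduces moments of every order to
    exponential moments. *)
Lemma powR_le_expR (R : realType) (q x : R) :
  0 < q -> 0 <= x -> x `^ q <= q `^ q * expR x.
Proof.
move=> q0 x0; have -> : x = q * (x / q) by field; rewrite gt_eqF.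
rewrite powRM ?(ltW q0) ?divr_ge0 ?(ltW q0)// ler_wpM2l ?powR_ge0//.
rewrite [q * _]mulrC expRM; apply: ge0_ler_powR; rewrite ?nnegrE ?(ltW q0)//.
  by rewrite divr_ge0// ltW.
by apply: le_trans (expR_ge1Dx _); rewrite lerDr.
Qed.

(** In the quadratic bound of the exponential at [r * (f x - mu)], the linear term integrates to
    zero and the square is at most [r ^+ 2]. *)
Lemma mgf_centered_le d (T : measurableType d) (R : realType)
    (P : probability T R) (f : T -> R) (mu r : R) :
  measurable_fun setT f -> (forall x, 0 <= f x <= 1) ->
  (\int[P]_x (f x)%:E = mu%:E)%E -> 0 <= r <= 1 ->
  (\int[P]_x (expR (r * (f x - mu)))%:E <= (1 + 2 * r ^+ 2)%:E)%E.
Proof.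
move=> mf f01 fmu /andP[r0 r1].
have f0 x : 0 <= f x by case/andP: (f01 x).
have f1 x : f x <= 1 by case/andP: (f01 x).
have mu0 : 0 <= mu.
  by rewrite -lee_fin -fmu; apply: integral_ge0 => x _; rewrite lee_fin.
have mu1 : mu <= 1.
  rewrite -lee_fin -fmu -(integral_prob_cst P 1%E).
  apply: ge0_le_integral => //; first by move=> x _; rewrite lee_fin.
    exact: measurableT_comp.
  by move=> x _; rewrite lee_fin.
have mexp : measurable_fun setT (fun x => (expR (r * (f x - mu)))%:E).
  apply: measurableT_comp => //; apply: measurableT_comp => //.
  by apply: measurable_funM => //; exact: measurable_funB.
have mrf : measurable_fun setT (fun x => (r * f x)%:E).
  by apply: measurableT_comp => //; exact: measurable_funM.
have rmu0 : 0 <= r * mu by exact: mulr_ge0.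
(* Both sides are shifted by [r * mu], so that the linear term becomes [r * f x] and all integrands
   stay nonnegative. *)
suff : (\int[P]_x (expR (r * (f x - mu)))%:E + (r * mu)%:E <=
        (1 + 2 * r ^+ 2)%:E + (r * mu)%:E)%E by rewrite leeD2rE.
have <- : (\int[P]_x ((expR (r * (f x - mu)))%:E + (r * mu)%:E) =
  \int[P]_x (expR (r * (f x - mu)))%:E + (r * mu)%:E)%E.
  by rewrite ge0_integralD// integral_prob_cst.
have <- : (\int[P]_x ((1 + 2 * r ^+ 2)%:E + (r * f x)%:E) =
  (1 + 2 * r ^+ 2)%:E + (r * mu)%:E)%E.
  rewrite ge0_integralD//.
  - rewrite integral_prob_cst; congr (_ + _)%E.
    under eq_integral do rewrite EFinM.
    rewrite ge0_integralZl_EFin ?fmu//; first by move=> x _; rewrite lee_fin.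
    exact: measurableT_comp.
  - by move=> x _; rewrite lee_fin addr_ge0// mulr_ge0// sqr_ge0.
  - by move=> x _; rewrite lee_fin mulr_ge0.
apply: ge0_le_integral => //.
- by move=> x _; rewrite lee_fin addr_ge0// expR_ge0.
- exact: emeasurable_funD.
- exact: emeasurable_funD.
move=> x _; rewrite -!EFinD lee_fin.
have /andP[fmu1 fmu2] : -1 <= f x - mu <= 1.
  by move: (f0 x) (f1 x) => ? ?; apply/andP; split; lra.
have h : r * (f x - mu) <= 1.
  by apply: (@le_trans _ _ (r * 1)); rewrite ?ler_wpM2l// mulr1.
apply: (le_trans (lerD (expR_le_quadratic h) (lexx _))).
have : (f x - mu) ^+ 2 <= 1 by nra.
move=> h2; have := ler_wpM2l (sqr_ge0 r) h2; rewrite exprMn; lra.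
Qed.

(** With r = n^(-1/2) and S the centered sum, the deviation of the mean is r (r S), and |r S|^q is
    at most q^q (exp(r S) + exp(-r S)). By independence each exponential has integral at most (1 +
    2/n)^n <= exp 2. *)
Lemma iid_mean_moment d (T : measurableType d) (R : realType)
    (P : probability T R) (f : T -> R) (mu q : R) (n : nat) :
  measurable_fun setT f -> (forall x, 0 <= f x <= 1) ->
  (\int[P]_x (f x)%:E = mu%:E)%E -> 0 < q -> (0 < n)%N ->
  (\int[iid P n]_t (`|n%:R^-1 * \sum_(i < n) f (tnth t i) - mu| `^ q)%:E
   <= (2 * q `^ q * expR 2 * n%:R `^ (- (q / 2)))%:E)%E.
Proof.
move=> mf f01 fmu q0 n0.
have n0' : 0 < n%:R :> R by rewrite ltr0n.
pose r : R := n%:R `^ (- 2^-1).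
have r0 : 0 <= r by exact: powR_ge0.
have r2 : r ^+ 2 = n%:R^-1.
  by rewrite -powR_mulrn// -powRrM mulNr mulVf// powR_inv1// ltW.
have rq : r `^ q = n%:R `^ (- (q / 2)).
  by rewrite /r -powRrM; congr (_ `^ _); field.
have r1 : r <= 1.
  by rewrite -(@ler_pXn2r _ 2)// ?nnegrE// r2 expr1n invf_le1// ler1n.
have r01 : 0 <= r <= 1 by rewrite r0.
have mexp (g : T -> R) (nu : R) : measurable_fun setT g ->
    measurable_fun setT (fun x => expR (r * (g x - nu))).
  move=> mg; apply: measurableT_comp => //.
  by apply: measurable_funM => //; exact: measurable_funB.
have mprod (g : T -> R) (nu : R) : measurable_fun setT g ->
    measurable_fun setT (fun t : n.-tuple T =>
      (\prod_(i < n) expR (r * (g (tnth t i) - nu)))%:E).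
  move=> mg; apply: measurableT_comp => //; apply: measurable_prod => i _.
  apply: (measurableT_comp (mexp _ nu mg)); exact: measurable_tnth.
have key (g : T -> R) (nu : R) : measurable_fun setT g ->
    (forall x, 0 <= g x <= 1) -> (\int[P]_x (g x)%:E = nu%:E)%E ->
    (\int[iid P n]_t (\prod_(i < n) expR (r * (g (tnth t i) - nu)))%:E
      <= (expR 2)%:E)%E.
  move=> mg g01 gnu; have := mgf_centered_le mg g01 gnu r01.
  set c := (\int[P]_x _)%E => c1.
  have c0 : (0 <= c)%E by apply: integral_ge0 => x _; rewrite lee_fin expR_ge0.
  have cfin : c \is a fin_num.
    by rewrite ge0_fin_numE// (le_lt_trans c1)// ltry.
  rewrite (@integral_iid_prod _ _ _ P n (fun x => expR (r * (g x - nu))) (fine c)).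
  - have cle : fine c <= expR (2 / n%:R).
      rewrite -lee_fin fineK//; apply: (le_trans c1); rewrite lee_fin r2.
      exact: expR_ge1Dx.
    rewrite lee_fin -[X in expR X](_ : 2 / n%:R * n%:R = 2).
      by rewrite expRM_natr lerXn2r// ?nnegrE ?expR_ge0// fine_ge0.
    by rewrite mulfVK// gt_eqF.
  - exact: mexp.
  - by move=> x; exact: expR_ge0.
  - by rewrite fineK.
(* The exponential of the opposite sum is the same bound applied to [1 - f], again with values in
   [0,1]. *)
pose g x := 1 - f x.
have mg : measurable_fun setT g by exact: measurable_funB.
have g01 x : 0 <= g x <= 1.
  by rewrite /g; case/andP: (f01 x) => ? ?; apply/andP; split; lra.
have gmu : (\int[P]_x (g x)%:E = (1 - mu)%:E)%E.
  have : (\int[P]_x ((g x)%:E + (f x)%:E) = 1)%E.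
    under eq_integral do rewrite -EFinD /g subrK.
    exact: integral_prob_cst.
  rewrite ge0_integralD//.
  - by rewrite fmu EFinB => <-; rewrite addeK.
  - by move=> x _; rewrite lee_fin; case/andP: (g01 x).
  - exact: measurableT_comp.
  - by move=> x _; rewrite lee_fin; case/andP: (f01 x).
  - exact: measurableT_comp.
pose F t := (\prod_(i < n) expR (r * (f (tnth t i) - mu)))%:E.
pose G t := (\prod_(i < n) expR (r * (g (tnth t i) - (1 - mu))))%:E.
have F0 t : (0 <= F t)%E by rewrite lee_fin prodr_ge0// => i _; exact: expR_ge0.
have G0 t : (0 <= G t)%E by rewrite lee_fin prodr_ge0// => i _; exact: expR_ge0.
have mF : measurable_fun setT F by exact: mprod.
have mG : measurable_fun setT G by exact: mprod.
have K0 : 0 <= q `^ q * n%:R `^ (- (q / 2)) by rewrite mulr_ge0// powR_ge0.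
apply: (@le_trans _ _ (\int[iid P n]_t
    ((q `^ q * n%:R `^ (- (q / 2)))%:E * (F t + G t)))%E).
  apply: ge0_le_integral => //.
  - apply: measurableT_comp => //; apply: (measurableT_comp (measurable_powR q)).
    apply: measurableT_comp => //; apply: measurable_funB => //.
    apply: measurable_funM => //; apply: measurable_sum => i.
    exact: (measurableT_comp mf (measurable_tnth i)).
  - by apply: emeasurable_funM => //; exact: emeasurable_funD.
  move=> t _; rewrite /F /G -EFinD -EFinM lee_fin.
  rewrite -!expR_sum -!mulr_sumr.
  set S := \sum_(i < n) (f _ - mu).
  have -> : \sum_(i < n) (g (tnth t i) - (1 - mu)) = - S.
    by rewrite /S -sumrN; apply: eq_bigr => i _; rewrite /g; ring.
  have -> : n%:R^-1 * \sum_(i < n) f (tnth t i) - mu = r * (r * S).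
    rewrite /S sumrB sumr_const card_ord mulrA -expr2 r2 mulrBr -mulr_natr.
    by congr (_ - _); field; rewrite gt_eqF.
  rewrite normrM (ger0_norm r0) powRM// rq.
  rewrite [X in _ <= X](_ : _ = n%:R `^ (- (q / 2)) *
    (q `^ q * (expR (r * S) + expR (r * - S)))); last by ring.
  rewrite ler_wpM2l ?powR_ge0//.
  apply: (le_trans (powR_le_expR q0 (normr_ge0 _))).
  rewrite ler_wpM2l ?powR_ge0// mulrN.
  have [h|h] := leP 0 (r * S).
    by rewrite ger0_norm// lerDl expR_ge0.
  by rewrite ltr0_norm// lerDr expR_ge0.
rewrite ge0_integralZl_EFin//.
- rewrite ge0_integralD//.
  apply: (@le_trans _ _ ((q `^ q * n%:R `^ (- (q / 2)))%:E *
    ((expR 2)%:E + (expR 2)%:E))%E).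
    by rewrite lee_wpmul2l ?lee_fin// leeD// key.
  by rewrite -EFinD -EFinM lee_fin le_eqVlt; apply/orP; left; apply/eqP; ring.
- by move=> t _; rewrite adde_ge0.
- exact: emeasurable_funD.
Qed.

(** * Gaussian tails and the margin condition *)

(** Peeling: [f] is dominated by the sum of the [w k] times the indicators of the [B k], which need
    not be disjoint, and the bounds K / 2^(k+1) sum to K. *)
Lemma le_integral_layers d (T : measurableType d) (R : realType)
    (mu : {measure set T -> \bar R}) (f : T -> \bar R) (B : nat -> set T)
    (w v : nat -> R) (K : R) :
  measurable_fun setT f -> (forall x, 0 <= f x)%E ->
  (forall k, measurable (B k)) -> (forall k, 0 <= w k) ->
  (forall x, f x = 0%E \/ exists2 k, B k x & (f x <= (w k)%:E)%E) ->
  (forall k, (mu (B k) <= (v k)%:E)%E) ->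
  (forall k, w k * v k <= K / (2 ^ k.+1)%:R) ->
  (\int[mu]_x f x <= K%:E)%E.
Proof.
move=> mf f0 mB w0 fw Bv wv.
pose h k x := ((w k)%:E * (\1_(B k) x)%:E)%E.
have h0 k x : (0 <= h k x)%E by rewrite mule_ge0// lee_fin.
have mh k : measurable_fun setT (h k).
  by apply: measurable_funeM; apply: measurableT_comp => //; exact: measurable_indic.
apply: (@le_trans _ _ (\int[mu]_x \big[+%E/0%R]_(0 <= k <oo) h k x)%E).
  apply: ge0_le_integral => //; first exact: ge0_emeasurable_sum.
  move=> x _; have [->|[k Bk fk]] := fw x; first exact: nneseries_ge0.
  apply: le_trans (nneseries_lim_ge k.+1 _) => //.
  rewrite big_nat_recr//=; apply: (le_trans fk).
  rewrite {2}/h indicE mem_set// mule1 leeDr//.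
  exact: sume_ge0.
rewrite integral_nneseries//.
have -> : K%:E = (\big[+%E/0%R]_(0 <= k <oo) (K / (2 ^ k.+1)%:R)%:E)%E.
  apply/esym/cvg_lim => //.
  have := @cvg_geometric_eseries_half R K 0; rewrite expr0 divr1 => h1.
  apply: cvg_trans h1; apply: near_eq_cvg; near=> N.
  by apply: eq_bigr => k _; rewrite addn1.
apply: lee_nneseries => [k _ _|k _]; first exact: integral_ge0.
rewrite /h ge0_integralZl_EFin//; last first.
  by apply: measurableT_comp => //; exact: measurable_indic.
rewrite integral_indic// setIT.
apply: (le_trans (lee_wpmul2l _ (Bv k))); rewrite ?lee_fin//.
Unshelve. all: by end_near. Qed.

(** The exponential of the maximum over real k of k q - c k^2 + (k + 1). *)
Definition gauss_decay {R : realType} (q c : R) : R :=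
  expR (1 + (q + 1) ^+ 2 / (4 * c)).

(** Bound k + 1 by exp k and 2^(k+1) by exp (k + 1), then complete the square in the exponent. The
    factor 2^(k+1) is what [le_integral_layers] asks for. *)
Lemma gauss_decay_le (R : realType) (q c : R) (k : nat) : 0 <= q -> 0 < c ->
  k.+1%:R `^ q * expR (- (c * k%:R ^+ 2)) <= gauss_decay q c / (2 ^ k.+1)%:R.
Proof.
move=> q0 c0.
rewrite ler_pdivlMr ?ltr0n ?expn_gt0//.
have e1 : k.+1%:R `^ q <= expR (k%:R * q).
  rewrite expRM; apply: ge0_ler_powR; rewrite ?nnegrE ?expR_ge0//.
  by apply: le_trans (expR_ge1Dx _); rewrite -natr1 addrC.
have e2 : (2 ^ k.+1)%:R <= expR k.+1%:R :> R.
  rewrite natrX -[k.+1%:R]mul1r expRM_natr lerXn2r// ?nnegrE ?expR_ge0//.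
  by apply: le_trans (expR_ge1Dx _); lra.
apply: (@le_trans _ _ (expR (k%:R * q) * expR (- (c * k%:R ^+ 2)) * expR k.+1%:R)).
  by apply: ler_pM => //; rewrite ?mulr_ge0 ?powR_ge0 ?expR_ge0// ler_wpM2r ?expR_ge0.
rewrite -!expRD ler_expR -natr1 -subr_ge0.
rewrite (_ : _ - _ = (2 * c * k%:R - (q + 1)) ^+ 2 / (4 * c)).
  by rewrite divr_ge0 ?sqr_ge0// mulr_ge0// ltW.
by field; rewrite gt_eqF.
Qed.

(** Peel along the integer part of V / s. The layer k = 0 has no tail bound; its trivial bound 1 is
    the reason for [1 + C] in place of [C]. *)
Lemma moment_of_gauss_tail d (T : measurableType d) (R : realType)
    (P : probability T R) (V : T -> R) (s C c q : R) :
  measurable_fun setT V -> (forall x, 0 <= V x) ->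
  0 < s -> 0 <= C -> 0 < c -> 0 < q ->
  (forall k : nat, (P [set x | (s * k.+1%:R <= V x)%R]
     <= (C * expR (- (c * k.+1%:R ^+ 2)))%:E)%E) ->
  (\int[P]_x (V x `^ q)%:E <= ((1 + C) * gauss_decay q c * s `^ q)%:E)%E.
Proof.
move=> mV V0 s0 C0 c0 q0 tail.
apply: (@le_integral_layers _ _ _ P _ (fun k => [set x | s * k%:R <= V x])
  (fun k => (s * k.+1%:R) `^ q) (fun k => (1 + C) * expR (- (c * k%:R ^+ 2)))).
- by apply: measurableT_comp => //; exact: (measurableT_comp (measurable_powR q)).
- by move=> x; rewrite lee_fin powR_ge0.
- move=> k; rewrite -[X in measurable X]setTI.
  by apply: measurable_fun_le.
- by move=> k; exact: powR_ge0.
- move=> x; right; exists (Num.truncn (V x / s)).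
    by have /andP[+ _] := truncn_itv (divr_ge0 (V0 x) (ltW s0));
      rewrite /= ler_pdivlMr// mulrC.
  rewrite lee_fin; apply: ge0_ler_powR; rewrite ?nnegrE ?(ltW q0) ?V0//.
    by rewrite mulr_ge0// ltW.
  have /andP[_ /ltW] := truncn_itv (divr_ge0 (V0 x) (ltW s0)).
  by rewrite ler_pdivrMr// mulrC.
- case=> [|k].
    apply: (le_trans (probability_le1 _ _)).
      rewrite -[X in measurable X]setTI; exact: measurable_fun_le.
    by rewrite expr0n/= mulr0 oppr0 expR0 mulr1 lee_fin lerDl.
  apply: (le_trans (tail k)); rewrite lee_fin ler_wpM2r ?expR_ge0//.
  by rewrite lerDr.
move=> k; rewrite powRM ?(ltW s0)//.
have := ler_wpM2l (mulr_ge0 (addr_ge0 ler01 C0) (powR_ge0 s q))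
  (gauss_decay_le k (ltW q0) c0).
by congr (_ <= _); ring.
Qed.

(* The estimation bound holds outside of a null set that depends on the
   deviation; restricting to a countable grid of deviations makes it uniform. *)
Lemma gauss_tail_of_grid d (T : measurableType d) (R : realType)
    (P : probability T R) (V : T -> R) (s C c t : R) :
  measurable_fun setT V -> 0 < s -> 0 <= C -> 0 < c -> 0 <= t ->
  (forall k : nat, (P [set x | (s * k.+1%:R <= V x)%R]
     <= (C * expR (- (c * k.+1%:R ^+ 2)))%:E)%E) ->
  (P [set x | (s * t <= V x)%R] <=
     ((1 + C) * expR c * expR (- (c / 2 * t ^+ 2)))%:E)%E.
Proof.
move=> mV s0 C0 c0 t0 tail.
have mle a : measurable [set x | a <= V x].
  by rewrite -[X in measurable X]setTI; exact: measurable_fun_le.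
have /andP[kt tk] := truncn_itv t0; set k := Num.truncn t in kt tk.
apply: (@le_trans _ _ (P [set x | s * k%:R <= V x])).
  apply: le_measure; [exact/mem_set/mle|exact/mem_set/mle|].
  by move=> x /=; apply: le_trans; rewrite ler_wpM2l// ltW.
apply: (@le_trans _ _ ((1 + C) * expR (- (c * k%:R ^+ 2)))%:E).
  case: k {kt tk} => [|k].
    apply: (le_trans (probability_le1 _ (mle _))).
    by rewrite expr0n/= mulr0 oppr0 expR0 mulr1 lee_fin lerDl.
  apply: (le_trans (tail k)); rewrite lee_fin ler_wpM2r ?expR_ge0//.
  by rewrite lerDr.
rewrite lee_fin -mulrA ler_wpM2l ?addr_ge0// -expRD ler_expR.
(* [k > t - 1] gives [k ^ 2 >= t ^ 2 / 2 - 1], by [(t - 2) ^ 2 >= 0]. *)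
suff : t ^+ 2 / 2 - 1 <= k%:R ^+ 2.
  by move=> h; have := ler_wpM2l (ltW c0) h; lra.
have k0 : 0 <= k%:R :> R by [].
rewrite -natr1 in tk; have [t1|t1] := leP t 1; first by nra.
have : (t - 1) ^+ 2 <= k%:R ^+ 2 by rewrite lerXn2r// ?nnegrE; lra.
by have := sqr_ge0 (t - 2); lra.
Qed.

(** Peel along the integer part k of u / s: on that layer the integrand is at most s (k+1) exp(-c
    k^2), and the margin bound gives the layer mass at most M (s (k+1))^alpha. The product carries
    s^(1 + alpha). *)
Lemma margin_gauss_le d (T : measurableType d) (R : realType)
    (mu : {measure set T -> \bar R}) (u : T -> R) (s M c alpha : R) :
  measurable_fun setT u -> (forall x, 0 <= u x) ->
  0 < s -> 0 <= M -> 0 < c -> 0 < alpha ->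
  (forall t, 0 < t -> (mu [set x | (0 < u x <= t)%R] <= (M * t `^ alpha)%:E)%E) ->
  (\int[mu]_x (u x * expR (- (c * (u x / s) ^+ 2)))%:E
    <= (M * gauss_decay (1 + alpha) c * s `^ (1 + alpha))%:E)%E.
Proof.
move=> mu_ u0 s0 M0 c0 a0 mar.
have mB t : measurable [set x | 0 < u x <= t].
  rewrite (_ : mkset _ = u @^-1` `]0, t]); last first.
    by apply/seteqP; split=> x /=; rewrite in_itv.
  by rewrite -[X in measurable X]setTI; exact: mu_.
apply: (@le_integral_layers _ _ _ mu _ (fun k => [set x | 0 < u x <= s * k.+1%:R])
  (fun k => s * k.+1%:R * expR (- (c * k%:R ^+ 2)))
  (fun k => M * (s * k.+1%:R) `^ alpha)).
- apply: measurableT_comp => //; apply: measurable_funM => //.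
  apply: measurableT_comp => //; apply: measurableT_comp => //.
  apply: measurable_funM => //; apply: measurable_funX.
  exact: measurable_funM.
- by move=> x; rewrite lee_fin mulr_ge0// expR_ge0.
- by move=> k; exact: mB.
- by move=> k; rewrite !mulr_ge0 ?expR_ge0 ?(ltW s0).
- move=> x; have [ux0|ux0] := eqVneq (u x) 0; [left|right].
    by rewrite ux0 mul0r.
  have {ux0}ux : 0 < u x by rewrite lt_neqAle eq_sym ux0 u0.
  have us0 : 0 <= u x / s by rewrite divr_ge0// ltW.
  have /andP[h1 /ltW h2] := truncn_itv us0.
  have h3 : u x <= s * (Num.truncn (u x / s)).+1%:R.
    by rewrite mulrC -ler_pdivrMr.
  exists (Num.truncn (u x / s)); first by rewrite /= ux.
  rewrite lee_fin; apply: ler_pM => //; rewrite ?expR_ge0//.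
  by rewrite ler_expR lerN2 ler_wpM2l ?(ltW c0)// lerXn2r// nnegrE.
- by move=> k; apply: mar; rewrite mulr_gt0.
move=> k; rewrite powRM ?(ltW s0)//.
have a1 : 0 <= 1 + alpha by rewrite addr_ge0// ltW.
have := ler_wpM2l (mulr_ge0 M0 (powR_ge0 s (1 + alpha))) (gauss_decay_le k a1 c0).
have pD (x : R) : 0 < x -> x `^ (1 + alpha) = x * x `^ alpha.
  move=> x0; rewrite powRD ?powRr1// ?ltW//.
  by apply/implyP => _; rewrite gt_eqF.
rewrite !pD//.
by congr (_ <= _); ring.
Qed.

(* Young's inequality for [x * a ^ (q - 1)]. *)
Lemma powR_tangent_le (R : realType) (q a x : R) :
  1 <= q -> 0 <= a -> 0 <= x ->
  q * x * a `^ (q - 1) - (q - 1) * a `^ q <= x `^ q.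
Proof.
rewrite le_eqVlt => /predU1P[<-|q1] a0 x0.
  by rewrite subrr powRr0 mul0r subr0 !mul1r mulr1 powRr1.
have q0 : 0 < q by lra.
have q10 : 0 < q - 1 by lra.
have := @conjugate_powR R x (a `^ (q - 1)) q (q / (q - 1)) x0 (powR_ge0 _ _) q0
  (divr_gt0 q0 q10).
rewrite -powRrM (_ : (q - 1) * (q / (q - 1)) = q); last by field; rewrite gt_eqF.
have <- : 1 = q^-1 + (q / (q - 1))^-1 by field; rewrite !gt_eqF.
move=> /(_ erefl) h; have := ler_wpM2l (ltW q0) h.
rewrite (_ : q * (_ + _) = x `^ q + (q - 1) * a `^ q); first by lra.
by field; rewrite !gt_eqF.
Qed.

(** Jensen's inequality: sum over i the tangent inequality at the mean A, where the affine terms add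
    up to n A^q. *)
Lemma powR_mean_le (R : realType) (q : R) (n : nat) (a : 'I_n -> R) :
  1 <= q -> (0 < n)%N -> (forall i, 0 <= a i) ->
  (n%:R^-1 * \sum_(i < n) a i) `^ q <= n%:R^-1 * \sum_(i < n) a i `^ q.
Proof.
move=> q1 n0 a0; set A := n%:R^-1 * _.
have n0' : 0 < n%:R :> R by rewrite ltr0n.
have A0 : 0 <= A by rewrite mulr_ge0 ?invr_ge0// ?sumr_ge0// ltW.
have : \sum_(i < n) (q * a i * A `^ (q - 1) - (q - 1) * A `^ q)
    <= \sum_(i < n) a i `^ q.
  by apply: ler_sum => i _; exact: powR_tangent_le.
rewrite sumrB sumr_const card_ord -mulr_suml -mulr_sumr.
have -> : \sum_(i < n) a i = n%:R * A by rewrite mulVKf// gt_eqF.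
move=> h; rewrite ler_pdivlMl//; apply: le_trans h.
have [A00|A00] := eqVneq A 0.
  rewrite A00 mulr0 mulr0 mul0r sub0r powR0 ?mulr0 ?mul0rn ?oppr0//.
  by rewrite gt_eqF// (lt_le_trans _ q1).
rewrite -mulr_natr.
have -> : A `^ q = A * A `^ (q - 1).
  rewrite -{2}[A]powRr1// -powRD; first by congr (_ `^ _); ring.
  by rewrite A00 implybT.
by rewrite le_eqVlt; apply/orP; left; apply/eqP; ring.
Qed.

(** * Optimal threshold and excess risk *)

Lemma bilipschitz_root (R : realType) (f : R -> R) (p L : R) :
  0 < p ->
  (forall x y, x <= y -> p * (y - x) <= f y - f x <= L * (y - x)) ->
  exists z, f z = 0.
Proof.
move=> p0 fpL.
have L0 : 0 < L.
  have := fpL 0 1 ler01; rewrite subr0 !mulr1 => /andP[h1 h2].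
  exact: lt_le_trans p0 (le_trans h1 h2).
have lip x y : `|f x - f y| <= L * `|x - y|.
  have [xy|/ltW yx] := leP x y.
    have /andP[h1 h2] := fpL _ _ xy.
    rewrite distrC [`|x - y|]distrC (ger0_norm (_ : 0 <= y - x)) ?subr_ge0//.
    by rewrite ger0_norm// (le_trans _ h1)// mulr_ge0 ?subr_ge0// ltW.
  have /andP[h1 h2] := fpL _ _ yx.
  rewrite (ger0_norm (_ : 0 <= x - y)) ?subr_ge0//.
  by rewrite ger0_norm// (le_trans _ h1)// mulr_ge0 ?subr_ge0// ltW.
have cf : continuous f.
  move=> x; apply/cvgrPdist_le => e e0.
  have h : \forall y \near x, `|x - y| < e / L.
    by apply: (@near_ball R R); rewrite divr_gt0.
  apply: filterS h => y /ltW; rewrite ler_pdivlMr// mulrC => h.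
  exact: le_trans (lip _ _) h.
(* With slope at least [p], the function has changed sign within this distance of 0. *)
pose c := `|f 0| / p.
have c0 : 0 <= c by rewrite divr_ge0// ltW.
have pc : p * c = `|f 0| by rewrite mulrC divfK// gt_eqF.
have cc : - c <= c by lra.
have fc : 0 <= f c.
  have /andP[+ _] := fpL _ _ c0; rewrite subr0 pc.
  by have := ler_norm (- f 0); rewrite normrN; lra.
have fNc : f (- c) <= 0.
  have := fpL (- c) 0; rewrite oppr_le0 => /(_ c0)/andP[+ _].
  by rewrite sub0r opprK pc; have := ler_norm (f 0); lra.
have [] := @IVT R f (- c) c 0 cc.
- exact: continuous_subspaceT.
- by rewrite ge_min fNc le_max fc orbT.
- by move=> z _ fz; exists z.
Qed.

Section plugin.
Context {R : realType} (d : nat).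
Local Notation point := 'rV[R]_d.
Local Notation obs := ('rV[R]_d * bool)%type.
Implicit Types (P : probability obs R) (eta : point -> R) (g : point -> bool).

Lemma measurable_pos_part eta (theta : R) :
  measurable_fun setT eta ->
  measurable_fun setT (fun x => Num.max (eta x - theta) 0).
Proof.
by move=> meta; apply: measurable_maxr => //; exact: measurable_funB.
Qed.

Lemma prob1_regression P eta : regression P eta ->
  (\int[marginal P]_x (eta x)%:E = (prob1 P)%:E)%E.
Proof.
case=> meta eta01 /(_ _ measurableT) <-.
rewrite /prob1 fineK ?fin_num_measure//.
  by congr (P _); apply/seteqP; split=> -[x []]//= [].
rewrite (_ : [set z | _] = setT `*` [set true]); first exact: measurableX.
by apply/seteqP; split=> -[x []]//= [].
Qed.

(** Two versions of the regression function have the same integral over every measurable set, hence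
    agree almost everywhere. The version hidden in [is_theta_star] can thus be exchanged for any
    other. *)
Lemma eq_integral_pos_part P eta eta' theta :
  regression P eta -> regression P eta' ->
  (\int[marginal P]_x (Num.max (eta x - theta) 0)%:E =
   \int[marginal P]_x (Num.max (eta' x - theta) 0)%:E)%E.
Proof.
move=> r r'; have [meta eta01 etaP] := r; have [meta' eta01' etaP'] := r'.
apply: ae_eq_integral => //.
- by apply: measurableT_comp => //; exact: measurable_pos_part.
- by apply: measurableT_comp => //; exact: measurable_pos_part.
have : ae_eq (marginal P) setT (EFin \o eta) (EFin \o eta').
  apply: integral_ae_eq => //.
  - apply/integrableP; split; first exact: measurableT_comp.
    under eq_integral.
      move=> x _; rewrite /= ger0_norm; last by case/andP: (eta01 x).
      over.
    by rewrite (prob1_regression r) ltry.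
  - exact: measurableT_comp.
  - by move=> E _ mE; rewrite -etaP// -etaP'.
by apply: filterS => x h xT; case: (h xT) => ->.
Qed.

Lemma is_theta_star_exists P eta : regression P eta -> 0 < prob1 P ->
  exists theta, is_theta_star P theta.
Proof.
move=> r b0; have [meta eta01 etaP] := r.
pose Q := marginal P.
pose I theta := (\int[Q]_x (Num.max (eta x - theta) 0)%:E)%E.
have mpp theta : measurable_fun setT (fun x => (Num.max (eta x - theta) 0)%:E).
  by apply: measurableT_comp => //; exact: measurable_pos_part.
have pp0 theta x : (0 <= (Num.max (eta x - theta) 0)%:E)%E.
  by rewrite lee_fin le_max lexx orbT.
have I0 theta : (0 <= I theta)%E by exact: integral_ge0.
have Ifin theta : I theta \is a fin_num.
  rewrite ge0_fin_numE//; apply: (@le_lt_trans _ _ (1 + `|theta|)%:E);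
    last exact: ltry.
  rewrite -(integral_prob_cst Q (1 + `|theta|)%:E).
  apply: ge0_le_integral => // x _; rewrite lee_fin ge_max.
  have /andP[? e1] := eta01 x; rewrite addr_ge0// andbT lerD//.
  by rewrite -normrN ler_norm.
have Imon x y : x <= y -> (I y <= I x <= I y + (y - x)%:E)%E.
  move=> xy; apply/andP; split.
    apply: ge0_le_integral => // t _; rewrite lee_fin.
    by rewrite ge_max !le_max lexx !orbT andbT lerD2l lerN2 xy.
  rewrite -(integral_prob_cst Q (y - x)%:E) -ge0_integralD//; last first.
    by move=> t _; rewrite lee_fin subr_ge0.
  apply: ge0_le_integral => //.
    by apply: emeasurable_funD => //; exact: measurable_cst.
  move=> t _; rewrite -EFinD lee_fin ge_max; apply/andP; split.
    rewrite -lerBlDr le_max; apply/orP; left; lra.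
  by rewrite addr_ge0 ?subr_ge0// le_max lexx orbT.
(* The integral [I] is nonincreasing and 1-Lipschitz in the threshold, so the slope lies between
   [prob1 P] and [prob1 P + 1]. *)
have [] := @bilipschitz_root R (fun t => t * prob1 P - fine (I t)) (prob1 P)
    (prob1 P + 1) b0.
  move=> x y xy; have /andP[h1 h2] := Imon _ _ xy.
  move: h1 h2; rewrite -(fineK (Ifin x)) -(fineK (Ifin y)) -EFinD !lee_fin => h1 h2.
  by apply/andP; split; lra.
move=> theta /= /eqP; rewrite subr_eq0 => /eqP thetaE.
have theta0 : 0 <= theta.
  by rewrite -(pmulr_lge0 _ b0) thetaE fine_ge0.
exists theta; split; last by exists eta => //; rewrite thetaE fineK.
(* Above 1 the positive part vanishes because [eta <= 1], while [theta * prob1 P] would be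
   positive. *)
rewrite theta0/= leNgt; apply/negP => theta1.
have : I theta = 0%E.
  rewrite /I; under eq_integral.
    move=> x _; rewrite max_r; first over.
    by have /andP[? ?] := eta01 x; lra.
  exact: integral0.
move=> Iz; move: thetaE; rewrite Iz/= => /eqP.
by rewrite mulf_eq0 !gt_eqF// (lt_trans _ theta1).
Qed.

Lemma theta_star_regression P eta : regression P eta -> 0 < prob1 P ->
  0 <= theta_star P <= 1 /\
  (\int[marginal P]_x (Num.max (eta x - theta_star P) 0)%:E
   = (theta_star P * prob1 P)%:E)%E.
Proof.
move=> r b0; have := is_theta_star_exists r b0 => /(xgetPex 0)[].
rewrite -/(theta_star P) => t01 [eta' r' ->]; split => //.
exact: eq_integral_pos_part.
Qed.

(* [|eta x - theta|] when [g x] differs from [theta < eta x], [0] otherwise. *)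
Definition regret eta (theta : R) g (x : point) : R :=
  Num.max (eta x - theta) 0 - (eta x - theta) * (g x)%:R.

Lemma regret_ge0 eta theta g x : 0 <= regret eta theta g x.
Proof.
rewrite /regret; case: (g x); rewrite ?mulr1 ?mulr0 ?subr0.
  by rewrite subr_ge0 le_max lexx.
by rewrite le_max lexx orbT.
Qed.

Lemma measurable_regret eta theta g :
  measurable_fun setT eta -> classifier g ->
  measurable_fun setT (regret eta theta g).
Proof.
move=> meta mg; apply: measurable_funB; first exact: measurable_pos_part.
apply: measurable_funM; first exact: measurable_funB.
rewrite (_ : (fun x => (g x)%:R) = (fun x => if g x then 1 else 0)); last first.
  by apply/funext => x; case: (g x).
exact: measurable_fun_ifT.
Qed.

(** Integrating [regret] term by term gives theta P(Y=1) - P(Y=1, g=1) + theta P(g=1), where the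
    equation of [theta_star] evaluates the positive part; factor out the denominator of F1. *)
Lemma F1_gap P eta g : regression P eta -> 0 < prob1 P -> classifier g ->
  (\int[marginal P]_x (regret eta (theta_star P) g x)%:E =
   ((theta_star P - F1 P g) *
     (prob1 P + fine (P [set z | g z.1])))%:E)%E.
Proof.
move=> r b0 mg; have [meta eta01 etaP] := r.
have [/andP[t0 t1] tE] := theta_star_regression r b0.
set theta := theta_star P in t0 t1 tE *.
pose B := g @^-1` [set true].
have mB : measurable B by rewrite -[B]setTI; exact: mg.
have QB : P [set z | g z.1] = marginal P B.
  by rewrite /marginal /distribution /pushforward; congr (P _).
have PB : P [set z | z.2 && g z.1] = (\int[marginal P]_(x in B) (eta x)%:E)%E.
  rewrite -etaP//; congr (P _).
  by apply/seteqP; split=> -[x []]//= []; rewrite /B/=.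
have mBB : measurable (B `*` [set true]) by exact: measurableX.
set A := P [set z | z.2 && g z.1] in PB *.
have Afin : A \is a fin_num by rewrite PB -etaP// fin_num_measure.
have Bfin : marginal P B \is a fin_num by rewrite fin_num_measure.
have mr : measurable_fun setT (fun x => (regret eta theta g x)%:E).
  by apply: measurableT_comp => //; exact: measurable_regret.
have r0 x : (0 <= (regret eta theta g x)%:E)%E by rewrite lee_fin regret_ge0.
(* The identity is first stated without subtraction, so that it is additivity of nonnegative
   integrals. *)
have key : ((theta * prob1 P)%:E + theta%:E * marginal P B =
    A + \int[marginal P]_x (regret eta theta g x)%:E)%E.
  have -> : marginal P B = (\int[marginal P]_x (\1_B x : R)%:E)%E.
    by rewrite integral_indic// setIT.
  rewrite PB [X in _ = (X + _)%E]integral_mkcond -tE.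
  have mi : measurable_fun setT (fun x => (\1_B x : R)%:E).
    by apply: measurableT_comp => //; exact: measurable_indic.
  have mpp : measurable_fun setT (fun x => (Num.max (eta x - theta) 0)%:E).
    by apply: measurableT_comp => //; exact: measurable_pos_part.
  rewrite -ge0_integralZl_EFin// -ge0_integralD//; last 3 first.
  - by move=> x _; rewrite lee_fin le_max lexx orbT.
  - by move=> x _; rewrite mule_ge0// lee_fin.
  - by apply: measurable_funeM.
  rewrite -ge0_integralD//; last 2 first.
  - by move=> x _; rewrite patchE; case: ifP => // _; rewrite lee_fin; case/andP: (eta01 x).
  - apply/(measurable_restrictT _ mB).
    by apply: measurable_funTS; exact: measurableT_comp.
  apply: eq_integral => x _; rewrite patchE indicE /regret.
  have -> : (x \in B) = g x.
    by apply/idP/idP; rewrite inE /B/= => h; exact: h.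
  by case: (g x); rewrite /= -?EFinM -!EFinD; congr EFin; ring.
have rfin : (\int[marginal P]_x (regret eta theta g x)%:E)%E \is a fin_num.
  have : (A + \int[marginal P]_x (regret eta theta g x)%:E)%E \is a fin_num.
    by rewrite -key fin_numD fin_numM.
  by rewrite fin_numD => /andP[].
move: key; rewrite -(fineK rfin) -(fineK Bfin) -(fineK Afin) -EFinM -!EFinD.
move=> [] key; congr EFin.
rewrite QB /F1 -/A QB mulrBl divfK; last first.
  by rewrite gt_eqF// ltr_pwDl// fine_ge0.
lra.
Qed.

(** By [F1_gap] and [regret_ge0] no classifier exceeds [theta_star]; the rule [theta_star P < eta x]
    has zero regret and attains it. This also shows that the choice in [g_star] is made from a
    nonempty set. *)
Lemma F1_g_star P eta : regression P eta -> 0 < prob1 P ->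
  F1 P (g_star P) = theta_star P.
Proof.
move=> r b0; have [meta eta01 etaP] := r.
have den0 g : 0 < prob1 P + fine (P [set z | g z.1]).
  by rewrite ltr_pwDl// fine_ge0.
have F1_le g : classifier g -> F1 P g <= theta_star P.
  move=> mg; rewrite -subr_ge0 -(pmulr_lge0 _ (den0 g)) -lee_fin.
  rewrite -(F1_gap r b0 mg); apply: integral_ge0 => x _.
  by rewrite lee_fin regret_ge0.
pose h x := theta_star P < eta x.
have mh : classifier h by exact: measurable_fun_ltr.
have F1h : F1 P h = theta_star P.
  have := F1_gap r b0 mh; rewrite integral0_eq; last first.
    move=> x _; congr EFin; rewrite /regret /h; case: ltP => hx.
      by rewrite max_l ?mulr1 ?subrr// subr_ge0 ltW.
    by rewrite max_r ?mulr0 ?subrr// subr_le0.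
  move=> /esym[] /eqP; rewrite mulf_eq0 (gt_eqF (den0 h)) orbF subr_eq0.
  by move=> /eqP.
have : exists g, classifier g /\ forall g', classifier g' -> F1 P g' <= F1 P g.
  by exists h; split => // g' mg'; rewrite F1h F1_le.
move=> /(xgetPex (cst false)); rewrite -/(g_star P) => -[mg gmax].
by apply/eqP; rewrite eq_le F1_le//= -F1h gmax.
Qed.

Lemma excess_ge0 P eta g : regression P eta -> 0 < prob1 P -> classifier g ->
  0 <= excess P g.
Proof.
move=> r b0 mg; rewrite /excess (F1_g_star r b0).
have den0 : 0 < prob1 P + fine (P [set z | g z.1]).
  by rewrite ltr_pwDl// fine_ge0.
rewrite -(pmulr_lge0 _ den0) -lee_fin -(F1_gap r b0 mg); apply: integral_ge0 => x _.
by rewrite lee_fin regret_ge0.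
Qed.

Lemma excess_le P eta g (p : R) : regression P eta -> 0 < p -> p <= prob1 P ->
  classifier g ->
  ((excess P g)%:E <=
    p^-1%:E * \int[marginal P]_x (regret eta (theta_star P) g x)%:E)%E.
Proof.
move=> r p0 pb mg; have b0 := lt_le_trans p0 pb.
rewrite (F1_gap r b0 mg) -EFinM lee_fin.
have := excess_ge0 r b0 mg; rewrite /excess (F1_g_star r b0) => e0.
rewrite mulrCA ler_peMr// ler_pdivlMl// mulr1 (le_trans pb)//.
by rewrite lerDl fine_ge0.
Qed.

End plugin.

(** * Empirical threshold *)

(* Truncating [ybar] below by [p] makes the slope in [theta] at least [p] for
   every sample, so that no event of small [ybar] has to be treated apart. *)
Definition emp_gap (R : realType) k (p ybar : R) (e : 'I_k -> R) (theta : R) : R :=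
  theta * Num.max ybar p - k%:R^-1 * \sum_(i < k) Num.max (e i - theta) 0.

Definition emp_root (R : realType) k (p ybar : R) (e : 'I_k -> R) : R :=
  xget 0 [set theta | emp_gap p ybar e theta = 0].

Section emp_root.
Context {R : realType} (k : nat) (p : R) (p0 : 0 < p).
Implicit Types (ybar x y theta : R) (e : 'I_k -> R).

Lemma mean_le_const (a : 'I_k -> R) (c : R) : 0 <= c -> (forall i, a i <= c) ->
  k%:R^-1 * \sum_(i < k) a i <= c.
Proof.
(* The empty mean is 0, since the inverse of 0 is 0. *)
move=> c0 ac; case: (posnP k) => [k0|k0].
  by have -> : k%:R = 0 :> R; [rewrite k0|rewrite invr0 mul0r].
rewrite ler_pdivrMl ?ltr0n//.
apply: (@le_trans _ _ (\sum_(i < k) c)); first exact: ler_sum.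
by rewrite sumr_const card_ord mulr_natl.
Qed.

(** The linear term has slope [Num.max ybar p], and the mean of positive parts is nonincreasing and
    1-Lipschitz. *)
Lemma emp_gap_bilipschitz ybar e x y : x <= y ->
  p * (y - x) <= emp_gap p ybar e y - emp_gap p ybar e x
    <= (Num.max ybar p + 1) * (y - x).
Proof.
move=> xy; have xy0 : 0 <= y - x by rewrite subr_ge0.
pose b i := Num.max (e i - x) 0 - Num.max (e i - y) 0.
have bl i : 0 <= b i.
  by rewrite subr_ge0 ge_max !le_max lexx !orbT andbT lerD2l lerN2 xy.
have bu i : b i <= y - x.
  rewrite lerBlDr ge_max; apply/andP; split.
    by rewrite -lerBlDl le_max; apply/orP; left; lra.
  by rewrite addr_ge0// le_max lexx orbT.
have -> : emp_gap p ybar e y - emp_gap p ybar e x =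
    Num.max ybar p * (y - x) + k%:R^-1 * \sum_(i < k) b i.
  by rewrite /emp_gap /b sumrB; ring.
have B0 : 0 <= k%:R^-1 * \sum_(i < k) b i by rewrite mulr_ge0 ?invr_ge0// sumr_ge0.
apply/andP; split.
  apply: (@le_trans _ _ (Num.max ybar p * (y - x))); last by rewrite lerDl.
  by rewrite ler_wpM2r// le_max lexx orbT.
by rewrite mulrDl mul1r lerD2l; exact: mean_le_const.
Qed.

Lemma emp_gap_lt ybar e x y : x < y -> emp_gap p ybar e x < emp_gap p ybar e y.
Proof.
move=> xy; have /andP[+ _] := emp_gap_bilipschitz ybar e (ltW xy).
by rewrite -subr_gt0; apply: lt_le_trans; rewrite mulr_gt0// subr_gt0.
Qed.

Lemma emp_gap_root ybar e : emp_gap p ybar e (emp_root p ybar e) = 0.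
Proof.
apply: (xgetPex 0 (P := [set theta | emp_gap p ybar e theta = 0])).
exact: (bilipschitz_root p0 (emp_gap_bilipschitz ybar e)).
Qed.

(** Strict monotonicity turns the superlevel sets of the root into conditions on [emp_gap] at a
    fixed level, hence measurability of the root. *)
Lemma le_emp_root ybar e t : (t <= emp_root p ybar e) = (emp_gap p ybar e t <= 0).
Proof.
have r0 := emp_gap_root ybar e.
have [tr|rt|->] := ltgtP t (emp_root p ybar e); last by rewrite r0 lexx.
  by have := emp_gap_lt ybar e tr; rewrite r0 => /ltW ->.
by have := emp_gap_lt ybar e rt; rewrite r0 => /lt_geF ->.
Qed.

Lemma measurable_emp_root d (Z : measurableType d) (ybar : Z -> R)
    (e : 'I_k -> Z -> R) :
  measurable_fun setT ybar -> (forall i, measurable_fun setT (e i)) ->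
  measurable_fun setT (fun z => emp_root p (ybar z) (e ^~ z)).
Proof.
move=> my me.
apply: (measurability (@RGenCInfty.G R)) => [|/= _ [_] [t] -> <-].
  exact: RGenCInfty.measurableE.
rewrite (_ : _ @^-1` _ = [set z | emp_gap p (ybar z) (e ^~ z) t <= 0]).
  apply: measurable_fun_le => //.
  apply: measurable_funB; last first.
    apply: measurable_funM => //; apply: measurable_sum => i.
    by apply: measurable_maxr => //; exact: measurable_funB.
  by apply: measurable_funM => //; exact: measurable_maxr.
by apply/seteqP; split=> z /=; rewrite in_itv/= andbT le_emp_root.
Qed.

(** Since the slope is at least [p], [p] times the distance to the root is at most the defect at
    [theta]. The defect is compared with the exact equation using that [Num.max _ p] and the
    positive part are 1-Lipschitz and that theta <= 1. *)
Lemma emp_root_error ybar e (eta : 'I_k -> R) theta b mu :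
  0 <= theta <= 1 -> p <= b -> theta * b = mu ->
  p * `|emp_root p ybar e - theta| <=
    `|ybar - b| + k%:R^-1 * \sum_(i < k) `|e i - eta i|
    + `|k%:R^-1 * \sum_(i < k) Num.max (eta i - theta) 0 - mu|.
Proof.
move=> /andP[t0 t1] pb tb; set r := emp_root p ybar e.
have h1 : p * `|r - theta| <= `|emp_gap p ybar e theta|.
  have [rt|/ltW tr] := leP r theta.
    have /andP[+ _] := emp_gap_bilipschitz ybar e rt.
    rewrite emp_gap_root subr0 distrC (ger0_norm (_ : 0 <= theta - r)) ?subr_ge0//.
    by move=> /le_trans; apply; exact: ler_norm.
  have /andP[+ _] := emp_gap_bilipschitz ybar e tr.
  rewrite emp_gap_root sub0r (ger0_norm (_ : 0 <= r - theta)) ?subr_ge0//.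
  by move=> /le_trans; apply; rewrite -normrN ler_norm.
apply: (le_trans h1).
have -> : emp_gap p ybar e theta = theta * (Num.max ybar p - Num.max b p)
    - k%:R^-1 * \sum_(i < k) (Num.max (e i - theta) 0 - Num.max (eta i - theta) 0)
    - (k%:R^-1 * \sum_(i < k) Num.max (eta i - theta) 0 - mu).
  by rewrite /emp_gap (max_l pb) sumrB -tb; ring.
apply: (le_trans (ler_normB _ _)); rewrite lerD2r.
apply: (le_trans (ler_normB _ _)); apply: lerD.
  rewrite normrM (ger0_norm t0).
  apply: (@le_trans _ _ (1 * `|Num.max ybar p - Num.max b p|)).
    by rewrite ler_wpM2r.
  rewrite mul1r (max_l pb); have [hp|//] := leP ybar p.
  by rewrite !ler0_norm; lra.
rewrite normrM ger0_norm ?invr_ge0// ler_wpM2l ?invr_ge0//.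
apply: (le_trans (ler_norm_sum _ _ _)); apply: ler_sum => i _.
by have [?|?] := leP (e i - theta) 0; have [?|?] := leP (eta i - theta) 0;
  rewrite ler_norml; apply/andP; split;
  have := ler_norm (e i - eta i); have := ler_norm (eta i - e i);
  rewrite (distrC (eta i)); lra.
Qed.

End emp_root.

(** The data enter F1 only through measures of sections of measurable sets, which depend measurably
    on the section point. *)
Lemma measurable_excess (R : realType) (d : nat)
    (P : probability ('rV[R]_d * bool)%type R) dD (D : measurableType dD)
    (ghat : D * 'rV[R]_d -> bool) : 0 < prob1 P -> measurable_fun setT ghat ->
  measurable_fun setT (fun z => excess P (fun x => ghat (z, x))).
Proof.
move=> b0 mg.
have mg' : measurable_fun setT
    (fun w : D * ('rV[R]_d * bool) => ghat (w.1, w.2.1)).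
  apply: (measurableT_comp mg); apply/measurable_fun_pair => //.
  exact: (measurableT_comp measurable_fst measurable_snd).
have mP (h : D * ('rV[R]_d * bool) -> bool) : measurable_fun setT h ->
    measurable_fun setT (fun z => fine (P [set w | h (z, w)])).
  move=> mh.
  have mA : measurable [set w | h w].
    by rewrite -[X in measurable X]setTI; exact: mh.
  have := measurable_fun_xsection P mA; rewrite /comp.
  move=> /(measurableT_comp (fine_measurable measurableT)).
  apply: eq_measurable_fun => z _ /=; congr (fine (P _)).
  by apply/seteqP; split=> w /=; rewrite xsectionE.
apply: measurable_funB => //; apply: measurable_funM.
  apply: (mP (fun w => w.2.2 && ghat (w.1, w.2.1))).
  apply: measurable_and => //.
  exact: (measurableT_comp measurable_snd measurable_snd).
rewrite [X in measurable_fun _ X](_ : _ =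
    fun z => (prob1 P + fine (P [set w | ghat (z, w.1)])) `^ (-1)); last first.
  by apply/funext => z; rewrite powR_inv1// addr_ge0 ?(ltW b0)// fine_ge0.
apply: (measurableT_comp (measurable_powR (-1))).
apply: measurable_funD => //; exact: (mP (fun w => ghat (w.1, w.2.1))).
Qed.

(** * Plug-in rule *)

Section halves.
Context d (T : measurableType d) (R : realType) (m k : nat).

Definition first_half (D : (m + k).-tuple T) : m.-tuple T :=
  [tuple tnth D (lshift k i) | i < m].

Definition second_half (D : (m + k).-tuple T) : k.-tuple T :=
  [tuple tnth D (rshift m i) | i < k].

Lemma first_half_catp z : first_half (catp z) = z.1.
Proof. by apply: eq_from_tnth => i; rewrite tnth_mktuple tnth_catp_lshift. Qed.

Lemma second_half_catp z : second_half (catp z) = z.2.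
Proof. by apply: eq_from_tnth => i; rewrite tnth_mktuple tnth_catp_rshift. Qed.

Lemma measurable_first_half : measurable_fun setT first_half.
Proof.
apply/measurable_fun_tnthP => i; rewrite /comp.
by under eq_fun do rewrite tnth_mktuple; exact: measurable_tnth.
Qed.

Lemma measurable_second_half : measurable_fun setT second_half.
Proof.
apply/measurable_fun_tnthP => i; rewrite /comp.
by under eq_fun do rewrite tnth_mktuple; exact: measurable_tnth.
Qed.

Lemma integral_first_half (P : probability T R) (f : m.-tuple T -> \bar R) :
  measurable_fun setT f -> (forall t, 0 <= f t)%E ->
  (\int[iid P (m + k)]_D f (first_half D) = \int[iid P m]_s f s)%E.
Proof.
move=> mf f0; rewrite integral_iidD//; last first.
  exact: (measurableT_comp mf measurable_first_half).
apply: eq_integral => s _; under eq_integral do rewrite first_half_catp.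
exact: (integral_prob_cst (iid P k) (f s)).
Qed.

Lemma integral_second_half (P : probability T R) (f : k.-tuple T -> \bar R) :
  measurable_fun setT f -> (forall t, 0 <= f t)%E ->
  (\int[iid P (m + k)]_D f (second_half D) = \int[iid P k]_t f t)%E.
Proof.
move=> mf f0; rewrite integral_iidD//; last first.
  exact: (measurableT_comp mf measurable_second_half).
under eq_integral do under eq_integral do rewrite second_half_catp.
exact: (integral_prob_cst (iid P m) (\int[iid P k]_t f t)%E).
Qed.

End halves.

Lemma mean_cste (R : realType) (k : nat) (c : \bar R) : (0 < k)%N ->
  (k%:R^-1%:E * \sum_(i < k) c = c)%E.
Proof.
move=> k0; have -> : (\sum_(i < k) c = k%:R%:E * c)%E.
  by rewrite mule_natl sumr_const card_ord.
by rewrite muleA -EFinM mulVf ?mul1e// pnatr_eq0 -lt0n.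
Qed.

Lemma integral_marginal (R : realType) d (P : probability ('rV[R]_d * bool)%type R)
    (f : 'rV[R]_d -> \bar R) :
  measurable_fun setT f -> (forall x, 0 <= f x)%E ->
  (\int[marginal P]_x f x = \int[P]_z f z.1)%E.
Proof.
move=> mf f0; rewrite /marginal /distribution.
by rewrite (ge0_integral_pushforward measurable_fst).
Qed.

Lemma powR_add3_le (R : realType) (q a b c : R) :
  0 <= q -> 0 <= a -> 0 <= b -> 0 <= c ->
  (a + b + c) `^ q <= 3 `^ q * (a `^ q + b `^ q + c `^ q).
Proof.
move=> q0 a0 b0 c0.
have key x : 0 <= x -> a <= x -> b <= x -> c <= x ->
    (a + b + c) `^ q <= 3 `^ q * x `^ q.
  move=> x0 ax bx cx; rewrite -powRM//; apply: ge0_ler_powR => //.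
  - by rewrite nnegrE !addr_ge0.
  - by rewrite nnegrE mulr_ge0.
  - by lra.
have [pa pb pc] := And3 (powR_ge0 a q) (powR_ge0 b q) (powR_ge0 c q).
have p3 : 0 <= 3 `^ q :> R by exact: powR_ge0.
have [ab|/ltW ba] := leP a b; have [bc|/ltW cb] := leP b c;
  have [ac|/ltW ca] := leP a c.
- by apply: (le_trans (key c _ _ _ _)) => //; rewrite ler_wpM2l//; lra.
- by apply: (le_trans (key c _ _ _ _)) => //; [lra|rewrite ler_wpM2l//; lra].
- by apply: (le_trans (key b _ _ _ _)) => //; rewrite ler_wpM2l//; lra.
- by apply: (le_trans (key b _ _ _ _)) => //; rewrite ler_wpM2l//; lra.
- by apply: (le_trans (key c _ _ _ _)) => //; rewrite ler_wpM2l//; lra.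
- by apply: (le_trans (key a _ _ _ _)) => //; rewrite ler_wpM2l//; lra.
- by apply: (le_trans (key a _ _ _ _)) => //; [lra|rewrite ler_wpM2l//; lra].
- by apply: (le_trans (key a _ _ _ _)) => //; rewrite ler_wpM2l//; lra.
Qed.

(** The factor (3/p)^q comes from the slope and from splitting a q-th power into three; the
    coefficient 4 collects the two centered means and the last summand is the moment of [etahat]. *)
Definition threshold_const {R : realType} (p C c q : R) : R :=
  (3 / p) `^ q * (4 * q `^ q * expR 2 + (1 + C) * gauss_decay q c).

(** The two summands correspond to u <= 2V and u <= 2W. The rate c / 8 is the tail rate c / 2 of
    [gauss_tail_of_grid] at the deviation u / (2s). *)
Definition classifier_const {R : realType} (alpha p C c M : R) : R :=
  p^-1 * M * ((1 + C) * expR c * gauss_decay (1 + alpha) (c / 8)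
    + 2 `^ (1 + alpha) * threshold_const p C c (1 + alpha)).

Section plugin_risk.
Context {R : realType} (d : nat).
Local Notation point := 'rV[R]_d.
Local Notation obs := ('rV[R]_d * bool)%type.
Context (P : probability obs R) (eta : point -> R) (p s C c : R) (m k : nat).
Context (etahat : m.-tuple obs * point -> R).
Hypotheses (eta_reg : regression P eta) (p0 : 0 < p) (pb : p <= prob1 P).
Hypotheses (s0 : 0 < s) (C0 : 0 < C) (c0 : 0 < c) (k0 : (0 < k)%N).
Hypothesis ks : k%:R `^ (- 2^-1) <= s.
Hypothesis metahat : measurable_fun setT etahat.
Hypothesis tail : {ae marginal P, forall x, forall j : nat,
  (iid P m [set D | s * j.+1%:R <= `|etahat (D, x) - eta x|]%R <=
     (C * expR (- (c * j.+1%:R ^+ 2)))%:E)%E}.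

Let V (S : m.-tuple obs) (x : point) : R := `|etahat (S, x) - eta x|.

Let V0 S x : 0 <= V S x. Proof. exact: normr_ge0. Qed.

Let meta : measurable_fun setT eta. Proof. by case: eta_reg. Qed.

Let b0 : 0 < prob1 P. Proof. exact: lt_le_trans p0 pb. Qed.

Let mV : measurable_fun setT (fun z => V z.1 z.2).
Proof.
apply: measurableT_comp => //; apply: measurable_funB.
  apply: (measurableT_comp metahat); exact/measurable_fun_pair.
exact: (measurableT_comp meta measurable_snd).
Qed.

Let mVx x : measurable_fun setT (V ^~ x).
Proof. exact: (measurableT_comp mV (pair2_measurable x)). Qed.

Definition theta_hat (D : (m + k).-tuple obs) : R :=
  emp_root p (k%:R^-1 * \sum_(i < k) (tnth (second_half D) i).2%:R)
    (fun i => etahat (first_half D, (tnth (second_half D) i).1)).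

Let mbool : measurable_fun setT (fun z : obs => z.2%:R : R).
Proof.
rewrite [X in measurable_fun _ X](_ : _ = fun z => if z.2 then 1 else 0).
  by apply: measurable_fun_ifT => //; exact: measurable_snd.
by apply/funext => z; case: z.2.
Qed.

Let msnd i : measurable_fun setT
  (fun D : (m + k).-tuple obs => tnth (second_half D) i).
Proof.
exact: (measurableT_comp (measurable_tnth i) (@measurable_second_half _ _ m k)).
Qed.

Let msecond i : measurable_fun setT
  (fun D : (m + k).-tuple obs => (first_half D, (tnth (second_half D) i).1)).
Proof.
apply/measurable_fun_pair; first exact: measurable_first_half.
exact: (measurableT_comp measurable_fst (msnd i)).
Qed.

Lemma measurable_theta_hat : measurable_fun setT theta_hat.
Proof.
apply: (measurable_emp_root p0
  (e := fun i D => etahat (first_half D, (tnth (second_half D) i).1))).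
  apply: measurable_funM => //; apply: measurable_sum => i.
  exact: (measurableT_comp mbool (msnd i)).
by move=> i; exact: (measurableT_comp metahat (msecond i)).
Qed.

Lemma etahat_moment (q : R) : 0 < q ->
  (\int[marginal P]_x \int[iid P m]_S (V S x `^ q)%:E
   <= ((1 + C) * gauss_decay q c * s `^ q)%:E)%E.
Proof.
move=> q0; rewrite -(integral_prob_cst (marginal P) _%:E).
have C1 : 0 <= (1 + C) * gauss_decay q c * s `^ q.
  by rewrite !mulr_ge0 ?powR_ge0 ?expR_ge0 ?addr_ge0// ltW.
apply: ae_ge0_le_integral => //.
- by move=> x _; apply: integral_ge0 => S _; rewrite lee_fin powR_ge0.
- apply: (@measurable_fun_fubini_tonelli_G _ _ _ _ R (iid P m)
    (fun z => (V z.1 z.2 `^ q)%:E)) => [|z]; last by rewrite lee_fin powR_ge0.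
  by apply: measurableT_comp => //; exact: (measurableT_comp (measurable_powR q)).
apply: filterS tail => x tx _.
by apply: (@moment_of_gauss_tail _ _ _ (iid P m) (V ^~ x)) => //; exact: ltW.
Qed.

Let Vmean (D : (m + k).-tuple obs) : R :=
  k%:R^-1 * \sum_(i < k) V (first_half D) (tnth (second_half D) i).1.

Let mVmean : measurable_fun setT Vmean.
Proof.
apply: measurable_funM => //; apply: measurable_sum => i.
exact: (measurableT_comp mV (msecond i)).
Qed.

(** Convexity bounds the power of the mean by the mean of powers. With the first half frozen, each
    term integrates to the same moment under the marginal; Tonelli then leads back to
    [etahat_moment]. *)
Let Vmean_moment (q : R) : 1 <= q ->
  (\int[iid P (m + k)]_D (Vmean D `^ q)%:E
   <= ((1 + C) * gauss_decay q c * s `^ q)%:E)%E.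
Proof.
move=> q1; have q0 : 0 < q by exact: lt_le_trans q1.
apply: le_trans (etahat_moment q0).
have mVq : measurable_fun setT (fun z => (V z.1 z.2 `^ q)%:E).
  by apply: measurableT_comp => //; exact: (measurableT_comp (measurable_powR q)).
have mVSq S : measurable_fun setT (fun x => (V S x `^ q)%:E).
  exact: (measurableT_comp mVq (pair1_measurable S)).
have -> : (\int[marginal P]_x \int[iid P m]_S (V S x `^ q)%:E =
    \int[iid P m]_S \int[marginal P]_x (V S x `^ q)%:E)%E.
  by apply/esym; apply: (@fubini_tonelli _ _ _ _ R (iid P m) (marginal P)
    (fun z => (V z.1 z.2 `^ q)%:E)) => // z; rewrite lee_fin powR_ge0.
rewrite integral_iidD.
- apply: ge0_le_integral => //.
  + by move=> S _; apply: integral_ge0 => t _; rewrite lee_fin powR_ge0.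
  + apply: (@measurable_fun_fubini_tonelli_F _ _ _ _ R (iid P k)
      (fun z => (Vmean (catp z) `^ q)%:E)) => [|z]; last by rewrite lee_fin powR_ge0.
    apply: measurableT_comp => //; apply: (measurableT_comp (measurable_powR q)).
    exact: (measurableT_comp mVmean (@measurable_catp _ _ m k)).
  + apply: (@measurable_fun_fubini_tonelli_F _ _ _ _ R (marginal P)
      (fun z => (V z.1 z.2 `^ q)%:E)) => // z; by rewrite lee_fin powR_ge0.
  move=> S _.
  have mi i : measurable_fun setT
      (fun t : k.-tuple obs => (V S (tnth t i).1 `^ q)%:E).
    apply: (measurableT_comp (mVSq S)).
    exact: (measurableT_comp measurable_fst (measurable_tnth i)).
  apply: (@le_trans _ _ (\int[iid P k]_t
    ((k%:R^-1)%:E * \sum_(i < k) (V S (tnth t i).1 `^ q)%:E))%E).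
    apply: ge0_le_integral => //.
    + by move=> t _; rewrite lee_fin powR_ge0.
    + apply: measurableT_comp => //; apply: (measurableT_comp (measurable_powR q)).
      apply: (measurableT_comp mVmean).
      exact: (measurableT_comp (@measurable_catp _ _ m k) (pair1_measurable S)).
    + by apply: measurable_funeM; exact: emeasurable_sum.
    move=> t _; rewrite sumEFin -EFinM lee_fin /Vmean first_half_catp second_half_catp.
    exact: powR_mean_le.
  rewrite ge0_integralZl_EFin//; last 2 first.
  + by move=> t _; apply: sume_ge0 => i _; rewrite lee_fin powR_ge0.
  + exact: emeasurable_sum.
  rewrite ge0_integral_sum//.
  under eq_bigr => i _.
    rewrite (@integral_iid_tnth _ _ _ P k i (fun z => (V S z.1 `^ q)%:E)).
    + over.
    + exact: (measurableT_comp (mVSq S) measurable_fst).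
    + by move=> z; rewrite lee_fin powR_ge0.
  rewrite (integral_marginal P (mVSq S)); last by move=> x; rewrite lee_fin powR_ge0.
    by rewrite mean_cste.
  by move=> i t _; rewrite lee_fin powR_ge0.
- by apply: measurableT_comp => //; exact: (measurableT_comp (measurable_powR q)).
- by move=> t; rewrite lee_fin powR_ge0.
Qed.

Let theta := theta_star P.

Let mpos : measurable_fun setT (fun x => Num.max (eta x - theta) 0).
Proof. exact: measurable_pos_part. Qed.

Let pos0 x : 0 <= Num.max (eta x - theta) 0.
Proof. by rewrite le_max lexx orbT. Qed.

Lemma theta_hat_moment (q : R) : 1 <= q ->
  (\int[iid P (m + k)]_D (`|theta_hat D - theta| `^ q)%:E
   <= (threshold_const p C c q * s `^ q)%:E)%E.
Proof.
move=> q1; have q0 : 0 < q by exact: lt_le_trans q1.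
have [theta01 thetaE] := theta_star_regression eta_reg b0.
(* The centered means are absorbed by the rate [s]. *)
have kq : k%:R `^ (- (q / 2)) <= s `^ q.
  rewrite (_ : - (q / 2) = - 2^-1 * q); last by field.
  by rewrite powRrM; apply: ge0_ler_powR; rewrite ?nnegrE ?powR_ge0// ltW.
pose A (t : k.-tuple obs) :=
  `|k%:R^-1 * \sum_(i < k) (tnth t i).2%:R - prob1 P| `^ q.
pose Z (z : obs) := Num.max (eta z.1 - theta) 0.
pose B (t : k.-tuple obs) :=
  `|k%:R^-1 * \sum_(i < k) Z (tnth t i) - theta * prob1 P| `^ q.
have mZ : measurable_fun setT Z by exact: (measurableT_comp mpos measurable_fst).
have mmean (f : obs -> R) mu : measurable_fun setT f ->
    measurable_fun setT (fun t : k.-tuple obs =>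
      (`|k%:R^-1 * \sum_(i < k) f (tnth t i) - mu| `^ q)%:E).
  move=> mf; apply: measurableT_comp => //.
  apply: (measurableT_comp (measurable_powR q)); apply: measurableT_comp => //.
  apply: measurable_funB => //; apply: measurable_funM => //.
  apply: measurable_sum => i; exact: (measurableT_comp mf (measurable_tnth i)).
have mA : measurable_fun setT (fun t => (A t)%:E) by exact: (mmean _ _ mbool).
have mB : measurable_fun setT (fun t => (B t)%:E) by exact: mmean.
have EA : (\int[iid P k]_t (A t)%:E <= (2 * q `^ q * expR 2 * s `^ q)%:E)%E.
  apply: (le_trans (iid_mean_moment (mu := prob1 P) mbool _ _ q0 k0)).
  - by move=> z; case: z.2; rewrite ?lexx ler01.
  - rewrite -(prob1_regression eta_reg); case: eta_reg => _ _ etaP.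
    rewrite -etaP// -[X in P X]setIT -integral_indic//; last exact: measurableX.
    apply: eq_integral => -[x y] _; rewrite indicE; congr (_%:R%:E).
    rewrite (_ : (_ \in _) = y)//; apply/idP/idP; rewrite inE /=; last by move=> ->.
    by case=> _ ->.
  - by rewrite lee_fin ler_wpM2l// !mulr_ge0 ?powR_ge0 ?expR_ge0.
have EB : (\int[iid P k]_t (B t)%:E <= (2 * q `^ q * expR 2 * s `^ q)%:E)%E.
  apply: (le_trans (iid_mean_moment (mu := theta * prob1 P) mZ _ _ q0 k0)).
  - move=> z; rewrite pos0 ge_max ler01 andbT.
    by case: eta_reg => _ /(_ z.1)/andP[? ?] _; case/andP: theta01; rewrite -/theta; lra.
  - rewrite -thetaE integral_marginal//; exact: measurableT_comp.
  - by rewrite lee_fin ler_wpM2l// !mulr_ge0 ?powR_ge0 ?expR_ge0.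
have EV := Vmean_moment q1.
have mA2 : measurable_fun setT
    (fun D => (A (@second_half _ _ m k D))%:E : \bar R).
  exact: (measurableT_comp mA (@measurable_second_half _ _ m k)).
have mB2 : measurable_fun setT
    (fun D => (B (@second_half _ _ m k D))%:E : \bar R).
  exact: (measurableT_comp mB (@measurable_second_half _ _ m k)).
have mVq : measurable_fun setT (fun D => (Vmean D `^ q)%:E).
  by apply: measurableT_comp => //; exact: (measurableT_comp (measurable_powR q)).
have A0 t : (0 <= (A t)%:E)%E by rewrite lee_fin powR_ge0.
have B0 t : (0 <= (B t)%:E)%E by rewrite lee_fin powR_ge0.
have Vq0 D : (0 <= (Vmean D `^ q)%:E)%E by rewrite lee_fin powR_ge0.
apply: (@le_trans _ _ (\int[iid P (m + k)]_D (((3 / p) `^ q)%:E *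
   ((A (second_half D))%:E + (Vmean D `^ q)%:E + (B (second_half D))%:E)))%E).
  apply: ge0_le_integral => //.
  - apply: measurableT_comp => //; apply: (measurableT_comp (measurable_powR q)).
    apply: measurableT_comp => //; apply: measurable_funB => //.
    exact: measurable_theta_hat.
  - by apply: measurable_funeM; do 2!apply: emeasurable_funD => //.
  move=> D _; rewrite -!EFinD -EFinM lee_fin.
  have := emp_root_error p0 (k%:R^-1 * \sum_(i < k) (tnth (second_half D) i).2%:R)
    (fun i => etahat (first_half D, (tnth (second_half D) i).1))
    (fun i => eta (tnth (second_half D) i).1) theta01 pb erefl.
  rewrite -/(theta_hat D) -/theta mulrC -ler_pdivlMr// => h.
  apply: (le_trans (ge0_ler_powR (ltW q0) _ _ h)); rewrite ?nnegrE//.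
    by rewrite divr_ge0 ?addr_ge0 ?(ltW p0)// mulr_ge0 ?invr_ge0// sumr_ge0.
  rewrite mulrC powRM ?invr_ge0 ?(ltW p0)//; last first.
    by rewrite !addr_ge0// mulr_ge0 ?invr_ge0// sumr_ge0.
  rewrite [3 / p]mulrC powRM ?invr_ge0 ?(ltW p0)// -mulrA ler_wpM2l ?powR_ge0//.
  apply: powR_add3_le => //; first exact: ltW.
  by rewrite mulr_ge0 ?invr_ge0// sumr_ge0.
rewrite ge0_integralZl_EFin ?powR_ge0//; last 2 first.
- by move=> D _; rewrite !adde_ge0.
- by do 2!apply: emeasurable_funD => //.
rewrite ge0_integralD//; last 2 first.
- by move=> D _; rewrite adde_ge0.
- exact: emeasurable_funD.
rewrite ge0_integralD//.
rewrite (integral_second_half m P mA)// (integral_second_half m P mB)//.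
apply: (@le_trans _ _ (((3 / p) `^ q)%:E *
  ((2 * q `^ q * expR 2 * s `^ q)%:E + ((1 + C) * gauss_decay q c * s `^ q)%:E +
    (2 * q `^ q * expR 2 * s `^ q)%:E))%E).
  by rewrite lee_wpmul2l ?lee_fin ?powR_ge0// !leeD.
rewrite -!EFinD -EFinM lee_fin /threshold_const le_eqVlt.
by apply/orP; left; apply/eqP; ring.
Qed.

Lemma plugin_classifier_risk (alpha M : R) : 0 < alpha -> 0 < M ->
  (forall t, 0 < t ->
    (marginal P [set x | (0 < `|eta x - theta| <= t)%R] <= (M * t `^ alpha)%:E)%E) ->
  (\int[iid P (m + k)]_D
     (excess P (fun x => (theta_hat D < etahat (first_half D, x))%R))%:E
   <= (classifier_const alpha p C c M * s `^ (1 + alpha))%:E)%E.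
Proof.
move=> a0 M0 mar; set Q := marginal P.
pose u x := `|eta x - theta|.
have u0 x : 0 <= u x by exact: normr_ge0.
have mu : measurable_fun setT u by apply: measurableT_comp => //; exact: measurable_funB.
pose W D := `|theta_hat D - theta|.
have W0 D : 0 <= W D by exact: normr_ge0.
have mW : measurable_fun setT W.
  by apply: measurableT_comp => //; apply: measurable_funB => //; exact: measurable_theta_hat.
(* [fA] carries the regret caused by [etahat] and [fB] the regret caused by the threshold. [fA]
   involves only the first half, so x can be frozen and the tail used. *)
pose fA (z : m.-tuple obs * point) :=
  if u z.2 <= 2 * V z.1 z.2 then u z.2 else 0.
pose fB (z : (m + k).-tuple obs * point) := if u z.2 <= 2 * W z.1 then u z.2 else 0.
have fA0 z : (0 <= (fA z)%:E)%E by rewrite lee_fin /fA; case: ifP.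
have fB0 z : (0 <= (fB z)%:E)%E by rewrite lee_fin /fB; case: ifP.
have mfA : measurable_fun setT (fun z => (fA z)%:E).
  apply: measurableT_comp => //; apply: measurable_fun_ifT => //.
    apply: measurable_fun_ler; first exact: (measurableT_comp mu measurable_snd).
    exact: measurable_funM.
  exact: (measurableT_comp mu measurable_snd).
have mfB : measurable_fun setT (fun z => (fB z)%:E).
  apply: measurableT_comp => //; apply: measurable_fun_ifT => //.
    apply: measurable_fun_ler; first exact: (measurableT_comp mu measurable_snd).
    apply: measurable_funM => //; exact: (measurableT_comp mW measurable_fst).
  exact: (measurableT_comp mu measurable_snd).
pose IA S := (\int[Q]_x (fA (S, x))%:E)%E.
pose IB D := (\int[Q]_x (fB (D, x))%:E)%E.
have IA0 S : (0 <= IA S)%E by exact: integral_ge0.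
have IB0 S : (0 <= IB S)%E by exact: integral_ge0.
have mIA : measurable_fun setT IA.
  exact: (@measurable_fun_fubini_tonelli_F _ _ _ _ R Q (fun z => (fA z)%:E)).
have mIB : measurable_fun setT IB.
  exact: (@measurable_fun_fubini_tonelli_F _ _ _ _ R Q (fun z => (fB z)%:E)).
have EA : (\int[iid P m]_S IA S <=
    (M * (1 + C) * expR c * gauss_decay (1 + alpha) (c / 8) * s `^ (1 + alpha))%:E)%E.
  have -> : (\int[iid P m]_S IA S = \int[Q]_x \int[iid P m]_S (fA (S, x))%:E)%E.
    exact: (@fubini_tonelli _ _ _ _ R (iid P m) Q (fun z => (fA z)%:E)).
  have mg : measurable_fun setT (fun x => (u x * expR (- (c / 8 * (u x / s) ^+ 2)))%:E).
    apply: measurableT_comp => //; apply: measurable_funM => //.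
    apply: measurableT_comp => //; apply: measurableT_comp => //.
    apply: measurable_funM => //; apply: measurable_funX.
    exact: measurable_funM.
  have K0 : 0 <= (1 + C) * expR c by rewrite mulr_ge0 ?expR_ge0// addr_ge0// ltW.
  apply: (@le_trans _ _ (\int[Q]_x (((1 + C) * expR c)%:E *
     (u x * expR (- (c / 8 * (u x / s) ^+ 2)))%:E))%E).
    apply: ae_ge0_le_integral => //.
    - by move=> x _; exact: integral_ge0.
    - exact: (@measurable_fun_fubini_tonelli_G _ _ _ _ R (iid P m) (fun z => (fA z)%:E)).
    - by move=> x _; rewrite mule_ge0 ?lee_fin// mulr_ge0// expR_ge0.
    - exact: measurable_funeM.
    apply: filterS tail => x tx _.
    pose E := [set S | s * (u x / (2 * s)) <= V S x].
    have mE : measurable E.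
      by rewrite -[E]setTI; exact: measurable_fun_le.
    have -> : (\int[iid P m]_S (fA (S, x))%:E = (u x)%:E * iid P m E)%E.
      rewrite -[E]setTI setIC -integral_indic// -ge0_integralZl_EFin//; last first.
        by apply: measurableT_comp => //; exact: measurable_indic.
      apply: eq_integral => S _; rewrite indicE -EFinM /fA/=; congr EFin.
      have -> : (S \in E) = (u x <= 2 * V S x).
        rewrite (_ : (_ <= _) = (s * (u x / (2 * s)) <= V S x)).
          by apply/idP/idP; rewrite inE.
        rewrite (_ : s * (u x / (2 * s)) = u x / 2); last by field; rewrite gt_eqF.
        by rewrite ler_pdivrMr// mulrC.
      by case: ifP; rewrite ?mulr1 ?mulr0.
    rewrite -EFinM mulrCA EFinM lee_wpmul2l ?lee_fin//.
    have := @gauss_tail_of_grid _ _ _ (iid P m) (V ^~ x) s C c (u x / (2 * s))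
      (mVx x) s0 (ltW C0) c0 (divr_ge0 (u0 x) _) tx.
    rewrite mulr_ge0 ?(ltW s0)// => /(_ isT) /le_trans; apply.
    rewrite lee_fin ler_wpM2l// ler_expR le_eqVlt; apply/orP; left; apply/eqP.
    by field; rewrite gt_eqF.
  rewrite ge0_integralZl_EFin//; last first.
    by move=> x _; rewrite lee_fin mulr_ge0// expR_ge0.
  have c8 : 0 < c / 8 by rewrite divr_gt0.
  have := margin_gauss_le (c := c / 8) mu u0 s0 (ltW M0) c8 a0 mar.
  move=> /(lee_wpmul2l (x := ((1 + C) * expR c)%:E)).
  rewrite lee_fin => /(_ K0) /le_trans; apply.
  by rewrite -EFinM lee_fin le_eqVlt; apply/orP; left; apply/eqP; ring.
have EB : (\int[iid P (m + k)]_D IB D <=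
    (M * (2 `^ (1 + alpha) * threshold_const p C c (1 + alpha)) * s `^ (1 + alpha))%:E)%E.
  apply: (@le_trans _ _ (\int[iid P (m + k)]_D
    ((M * 2 `^ (1 + alpha))%:E * (W D `^ (1 + alpha))%:E))%E).
    apply: ge0_le_integral => //.
      apply: measurable_funeM; apply: measurableT_comp => //.
      exact: (measurableT_comp (measurable_powR _)).
    move=> D _; rewrite -EFinM -mulrA -powRM//.
    (* Points with [u x = 0] escape the margin condition, but [fB] vanishes there. *)
    pose E := [set x | 0 < u x <= 2 * W D].
    have mE : measurable E.
      rewrite (_ : E = u @^-1` `]0, 2 * W D]); last first.
        by apply/seteqP; split=> x /=; rewrite in_itv.
      by rewrite -[X in measurable X]setTI; exact: mu.
    apply: (@le_trans _ _ ((2 * W D)%:E * Q E)%E).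
      rewrite -[E]setTI setIC -integral_indic// -ge0_integralZl_EFin//; first last.
      - by rewrite mulr_ge0.
      - by apply: measurableT_comp => //; exact: measurable_indic.
      apply: ge0_le_integral => //.
      - exact: (measurableT_comp mfB (pair1_measurable D)).
      - by apply: measurable_funeM; apply: measurableT_comp => //; exact: measurable_indic.
      move=> x _; rewrite -EFinM lee_fin /fB/= indicE.
      case: ifP => [h|_]; last by rewrite !mulr_ge0.
      have [ux0|ux0] := eqVneq (u x) 0; first by rewrite ux0 !mulr_ge0.
      by rewrite mem_set ?mulr1//= /E/= h andbT lt_neqAle eq_sym ux0 u0.
    (* The margin bound is stated at positive levels only. *)
    have [WD|WD] := eqVneq (W D) 0.
      by rewrite WD mulr0 mul0e lee_fin mulr_ge0 ?powR_ge0// ltW.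
    have W20 : 0 < 2 * W D by rewrite mulr_gt0// lt_neqAle eq_sym WD W0.
    apply: (le_trans (lee_wpmul2l _ (mar _ W20))); first by rewrite lee_fin ltW.
    rewrite -EFinM lee_fin powRD; last by rewrite (gt_eqF W20) implybT.
    by rewrite powRr1 ?(ltW W20)// mulrCA.
  have MM0 : 0 <= M * 2 `^ (1 + alpha) by rewrite mulr_ge0 ?powR_ge0// ltW.
  rewrite ge0_integralZl_EFin//; last 2 first.
  - by move=> D _; rewrite lee_fin powR_ge0.
  - by apply: measurableT_comp => //; exact: (measurableT_comp (measurable_powR _)).
  have a1 : 1 <= 1 + alpha by rewrite lerDl ltW.
  have := theta_hat_moment a1 => /(lee_wpmul2l (x := (M * 2 `^ (1 + alpha))%:E)).
  rewrite lee_fin => /(_ MM0) /le_trans; apply.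
  by rewrite -EFinM lee_fin le_eqVlt; apply/orP; left; apply/eqP; ring.
have mghat : measurable_fun setT
    (fun z : (m + k).-tuple obs * point => theta_hat z.1 < etahat (first_half z.1, z.2)).
  apply: measurable_fun_ltr.
    exact: (measurableT_comp measurable_theta_hat measurable_fst).
  apply: (measurableT_comp metahat); apply/measurable_fun_pair => //.
  exact: (measurableT_comp (@measurable_first_half _ _ m k) measurable_fst).
have mg D : classifier (fun x => theta_hat D < etahat (first_half D, x)).
  exact: (measurableT_comp mghat (pair1_measurable D)).
have mIA1 : measurable_fun setT (fun D => IA (@first_half _ _ m k D)).
  exact: (measurableT_comp mIA (@measurable_first_half _ _ m k)).
apply: (@le_trans _ _ (\int[iid P (m + k)]_D
    (p^-1%:E * (IA (first_half D) + IB D)))%E).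
  apply: ge0_le_integral => //.
  - by move=> D _; rewrite lee_fin; exact: (excess_ge0 eta_reg b0).
  - apply: measurableT_comp => //.
    exact: (measurable_excess (D := (m + k).-tuple obs) b0 mghat).
  - by apply: measurable_funeM; exact: emeasurable_funD.
  move=> D _; apply: (le_trans (excess_le eta_reg p0 pb (mg D))).
  rewrite lee_wpmul2l ?lee_fin ?invr_ge0 ?(ltW p0)//.
  have mfA1 := measurableT_comp mfA (pair1_measurable (first_half D)).
  have mfB1 := measurableT_comp mfB (pair1_measurable D).
  rewrite -ge0_integralD//.
  apply: ge0_le_integral => //.
  - by move=> x _; rewrite lee_fin regret_ge0.
  - by apply: measurableT_comp => //; exact: measurable_regret.
  - exact: emeasurable_funD.
  move=> x _; rewrite -EFinD lee_fin.
  have fA0' : 0 <= fA (first_half D, x) by rewrite -lee_fin.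
  have fB0' : 0 <= fB (D, x) by rewrite -lee_fin.
  have uVW : u x <= V (first_half D) x + W D -> u x <= fA (first_half D, x) + fB (D, x).
    move=> h; have [hA|hA] := leP (u x) (2 * V (first_half D) x).
      by rewrite {1}/fA/= hA lerDl.
    have hB : u x <= 2 * W D by lra.
    by rewrite /fB/= hB lerDr.
  (* In a disagreement [eta x] and [etahat] lie on opposite sides of their respective thresholds, so
     the two deviations V and W together cover the distance from [eta x] to [theta]. *)
  rewrite /regret -/theta; case: ltP => hx; rewrite ?mulr1 ?mulr0 ?subr0.
    have [e1|e1] := leP 0 (eta x - theta).
      by rewrite subrr addr_ge0.
    rewrite sub0r -ltr0_norm//; apply: uVW.
    rewrite /u /V /W (ltr0_norm e1).
    by have := ler_norm (etahat (first_half D, x) - eta x);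
      have := ler_norm (theta - theta_hat D); rewrite (distrC theta); lra.
  have [e1|e1] := leP (eta x - theta) 0; first exact: addr_ge0.
  rewrite -[leLHS](gtr0_norm e1); apply: uVW.
  rewrite /u /V /W (gtr0_norm e1).
  by have := ler_norm (eta x - etahat (first_half D, x));
    have := ler_norm (theta_hat D - theta); rewrite (distrC (eta x)); lra.
have pi0 : 0 <= p^-1 by rewrite invr_ge0 ltW.
rewrite ge0_integralZl_EFin//; last 2 first.
- by move=> D _; exact: adde_ge0.
- exact: emeasurable_funD.
rewrite ge0_integralD// (integral_first_half k P mIA)//.
have := lee_wpmul2l (x := p^-1%:E) _ (leeD EA EB).
rewrite lee_fin => /(_ pi0) /le_trans; apply.
rewrite -EFinD -EFinM lee_fin /classifier_const le_eqVlt.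
by apply/orP; left; apply/eqP; ring.
Qed.

End plugin_risk.

(* For [t > delta0] a probability is at most [1 <= (t / delta0) ^ alpha]. *)
Lemma margin_extend (R : realType) (d : nat) (alpha C0 delta0 : R)
    (P : probability ('rV[R]_d * bool)%type R) (eta : 'rV[R]_d -> R) :
  0 < alpha -> 0 < C0 -> 0 < delta0 -> measurable_fun setT eta ->
  margin alpha C0 delta0 P eta -> forall t, 0 < t ->
  (marginal P [set x | (0 < `|eta x - theta_star P| <= t)%R]
    <= ((C0 + delta0 `^ (- alpha)) * t `^ alpha)%:E)%E.
Proof.
move=> a0 C00 d0 meta mar t t0; have [td|dt] := leP t delta0.
  apply: (le_trans (mar t _)); first by rewrite t0.
  by rewrite lee_fin ler_wpM2r ?powR_ge0// lerDl powR_ge0.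
apply: (le_trans (probability_le1 _ _)).
  rewrite (_ : mkset _ = (fun x => `|eta x - theta_star P|) @^-1` `]0, t]); last first.
    by apply/seteqP; split=> x /=; rewrite in_itv.
  rewrite -[X in measurable X]setTI.
  have mu : measurable_fun setT (fun x => `|eta x - theta_star P|).
    by apply: measurableT_comp => //; exact: measurable_funB.
  exact: mu.
rewrite lee_fin mulrDl; apply: ler_wpDl.
  by rewrite mulr_ge0 ?powR_ge0// ltW.
rewrite powRN -ler_pdivrMl ?invr_gt0 ?powR_gt0// invrK mulr1.
by apply: ge0_ler_powR; rewrite ?nnegrE ltW// (lt_trans d0).
Qed.

Lemma integral_sample_law_fst (R : realType) (d n N : nat)
    (P : probability ('rV[R]_d * bool)%type R)
    (f : n.-tuple ('rV[R]_d * bool) -> \bar R) :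
  measurable_fun setT f -> (forall D, 0 <= f D)%E ->
  (\int[@sample_law R d P n N]_D f D.1 = \int[iid P n]_D f D)%E.
Proof.
move=> mf f0; rewrite /sample_law.
rewrite (@fubini_tonelli1 _ _ _ _ R (iid P n) (iid (marginal P) N) (fun D => f D.1))//.
  by apply: eq_integral => D _; exact: (integral_prob_cst (iid (marginal P) N) (f D)).
exact: (measurableT_comp mf measurable_fst).
Qed.

(** * Rates as powers of the sample size, and the minimax bounds *)

Section rates.
Context {R : realType} (beta : R) (d : nat) (b0 : 0 < beta).
Let r : R := beta / (2 * beta + d%:R).

Let den0 : 0 < 2 * beta + d%:R :> R.
Proof. by rewrite ltr_pwDl ?mulr_gt0. Qed.

Let r0 : 0 <= r. Proof. by rewrite divr_ge0 ?ltW. Qed.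

Let r2 : r <= 2^-1.
Proof.
rewrite ler_pdivrMr// mulrDr mulKf ?pnatr_eq0// lerDl.
by rewrite mulr_ge0.
Qed.

(** The exponent r = beta / (2 beta + d) is at most 1/2, so the rate of empirical means is never the
    slower one. *)
Lemma invsqrt_le_rate (m k : nat) : (0 < m <= k)%N ->
  k%:R `^ (- 2^-1) <= m%:R `^ (- r).
Proof.
move=> /andP[m0 mk]; apply: (@le_trans _ _ (m%:R `^ (- 2^-1))).
  rewrite !powRN lef_pV2 ?posrE ?powR_gt0 ?ltr0n//; last exact: leq_trans mk.
  by apply: ge0_ler_powR; rewrite ?nnegrE ?ler_nat.
by apply: ler_powR; rewrite ?ler1n// lerN2.
Qed.

(** At deviations [s * j.+1%:R] the sample size thus cancels from the exponent of the estimation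
    bound. *)
Lemma rate_scale (m : nat) : (0 < m)%N ->
  m%:R `^ (2 * beta / (2 * beta + d%:R)) * (m%:R `^ (- r)) ^+ 2 = 1 :> R.
Proof.
move=> m0; rewrite -powR_mulrn ?powR_ge0// -powRrM -powRD; last first.
  by rewrite pnatr_eq0 -lt0n m0 implybT.
by rewrite (_ : _ + _ = 0) ?powRr0// /r; field; rewrite gt_eqF.
Qed.

Lemma rate_split (m n : nat) (q : R) : (0 < n <= 3 * m)%N -> 0 < q ->
  (m%:R `^ (- r)) `^ q <= 3 `^ q * n%:R `^ (- (q * r)).
Proof.
move=> /andP[n0 nm] q0; rewrite -powRrM mulNr [r * q]mulrC.
have m0 : (0 < m)%N by rewrite lt0n; apply: contraTneq nm => ->; rewrite -ltnNge.
have qr0 : 0 <= q * r by rewrite mulr_ge0// ltW.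
rewrite !powRN ler_pdivlMr ?powR_gt0 ?ltr0n// ler_pdivrMl ?powR_gt0 ?ltr0n//.
apply: (@le_trans _ _ ((3 * m%:R) `^ (q * r))).
  apply: ge0_ler_powR => //; last by rewrite -natrM ler_nat.
    by rewrite nnegrE.
  by rewrite nnegrE mulr_ge0.
rewrite powRM// [leRHS]mulrC ler_wpM2r ?powR_ge0//.
apply: ler_powR; first by rewrite ler1n.
by rewrite ler_piMr ?(ltW q0)// (le_trans r2)// invf_le1// ler1n.
Qed.

End rates.

Theorem corollary1 (R : realType) (d : nat) (alpha p C0 C1 C2 : R)
    (hd : (0 < d)%N) (halpha : 0 < alpha) (hp : 0 < p) (hC0 : 0 < C0)
    (hC1 : 0 < C1) (hC2 : 0 < C2) :
  exists (C : R -> R) (B : R),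
    (forall delta0 : R, 0 < delta0 <= 12^-1 -> 0 < C delta0) /\ 0 < B /\
    forall beta L c0 r0 mumin mumax delta0 : R,
      0 < beta -> 0 < L -> 0 < c0 -> 0 < r0 -> 0 < mumin -> 0 < mumax ->
      0 < delta0 <= 12^-1 ->
      estimation_bound d beta L c0 r0 mumin mumax C1 C2 ->
      forall n N : nat, (1 < n)%N -> (1 < N)%N ->
        (minimax_classifier
           (P_Sigma d alpha C0 delta0 p beta L c0 r0 mumin mumax) n N
         <= (C delta0 * n%:R `^ (- ((1 + alpha) * beta / (2 * beta + d%:R))))%:E)%E
        /\
        (minimax_threshold
           (P_Sigma d alpha C0 delta0 p beta L c0 r0 mumin mumax) n N
         <= (B * n%:R `^ (- (beta / (2 * beta + d%:R))))%:E)%E.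
Proof.
have a1 : 0 < 1 + alpha by rewrite addr_gt0.
(* The constant of [margin_extend], through which the classification constant depends on
   [delta0]. *)
pose M delta0 := C0 + delta0 `^ (- alpha).
have M0 delta0 : 0 < M delta0 by rewrite ltr_pwDl ?powR_ge0.
have T0 q : 0 < q -> 0 < threshold_const p C1 C2 q.
  move=> q0; rewrite mulr_gt0 ?powR_gt0 ?divr_gt0// ltr_pwDl//.
    by rewrite !mulr_gt0 ?powR_gt0 ?expR_gt0.
  by rewrite mulr_ge0 ?expR_ge0// addr_ge0// ltW.
have K0 delta0 : 0 < classifier_const alpha p C1 C2 (M delta0).
  rewrite /classifier_const !mulr_gt0 ?invr_gt0// ltr_pwDr//.
    by rewrite mulr_gt0 ?powR_gt0// T0.
  by rewrite !mulr_ge0 ?expR_ge0// addr_ge0// ltW.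
exists (fun delta0 => 3 `^ (1 + alpha) * classifier_const alpha p C1 C2 (M delta0)).
exists (3 * threshold_const p C1 C2 1).
split; first by move=> delta0 _; rewrite mulr_gt0 ?powR_gt0.
split; first by rewrite mulr_gt0 ?T0.
move=> beta L c0 r0 mumin mumax delta0 b0 _ _ _ _ _ /andP[d0 _] est n N n1 _.
(* The smaller half goes to [etahat]; the worst ratio is 3, reached at n = 3. *)
have [m [k [nE m0 mk nm]]] : exists m k,
    [/\ n = (m + k)%N, (0 < m)%N, (m <= k)%N & (n <= 3 * m)%N].
  exists n./2, (n - n./2)%N; split; lia.
subst n; have k0 : (0 < k)%N by exact: leq_trans mk.
pose r := beta / (2 * beta + d%:R).
pose s : R := m%:R `^ (- r).
have s0 : 0 < s by rewrite powR_gt0// ltr0n.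
have ks : k%:R `^ (- 2^-1) <= s by apply: invsqrt_le_rate => //; rewrite m0.
have rate q : 0 < q -> s `^ q <= 3 `^ q * (m + k)%:R `^ (- (q * r)).
  by move=> q0; apply: rate_split => //; rewrite addn_gt0 m0.
have [etahat [metahat tail]] := est m m0.
have tailP P : P_Sigma d alpha C0 delta0 p beta L c0 r0 mumin mumax P ->
    exists eta, [/\ regression P eta, p <= prob1 P,
      forall t, 0 < t ->
        (marginal P [set x | (0 < `|eta x - theta_star P| <= t)%R]
          <= (M delta0 * t `^ alpha)%:E)%E &
      {ae marginal P, forall x, forall j : nat,
        (iid P m [set D | s * j.+1%:R <= `|etahat (D, x) - eta x|]%R <=
         (C1 * expR (- (C2 * j.+1%:R ^+ 2)))%:E)%E}].
  move=> [eta [reg mar pb hol den]]; exists eta; split => //.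
    by apply: margin_extend => //; case: reg.
  (* The exceptional null set depends on the deviation, and countably many of them still form a null
     set. *)
  apply/ae_foralln => j.
  have := tail P eta reg hol den (s * j.+1%:R) (mulr_gt0 s0 (ltr0Sn _ _)).
  apply: filterS => x /le_trans; apply; rewrite lee_fin.
  by rewrite exprMn mulrA -(mulrA C2) rate_scale// mulr1.
have mth := measurable_theta_hat (k := k) hp metahat.
split.
  pose ghat (z : (m + k).-tuple ('rV[R]_d * bool) * N.-tuple 'rV[R]_d * 'rV[R]_d) :=
    theta_hat p etahat z.1.1 < etahat (first_half z.1.1, z.2).
  have mghat : classifier_estimator ghat.
    have mD : measurable_fun setT (fun z :
        (m + k).-tuple ('rV[R]_d * bool) * N.-tuple 'rV[R]_d * 'rV[R]_d => z.1.1).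
      exact: (measurableT_comp measurable_fst measurable_fst).
    apply: measurable_fun_ltr; first exact: (measurableT_comp mth mD).
    apply: (measurableT_comp metahat); apply/measurable_fun_pair => //.
    exact: (measurableT_comp (@measurable_first_half _ _ m k) mD).
  apply: (@le_trans _ _ (ereal_sup [set classifier_risk P ghat |
    P in P_Sigma d alpha C0 delta0 p beta L c0 r0 mumin mumax])).
    by apply: ereal_inf_lbound; exists ghat.
  apply: ge_ereal_sup => _ [P /tailP[eta [reg pb mar tl]] <-].
  have pb0 := lt_le_trans hp pb.
  have mghat' : measurable_fun setT (fun z : (m + k).-tuple ('rV[R]_d * bool) * 'rV[R]_d =>
      theta_hat p etahat z.1 < etahat (first_half z.1, z.2)).
    apply: measurable_fun_ltr; first exact: (measurableT_comp mth measurable_fst).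
    apply: (measurableT_comp metahat); apply/measurable_fun_pair => //.
    exact: (measurableT_comp (@measurable_first_half _ _ m k) measurable_fst).
  rewrite /classifier_risk (@integral_sample_law_fst _ _ _ N P (fun D => (excess P
    (fun x => theta_hat p etahat D < etahat (first_half D, x)))%:E)).
  - apply: (le_trans (plugin_classifier_risk reg hp pb s0 hC1 hC2 k0 ks metahat tl
      halpha (M0 delta0) mar)).
    have := ler_wpM2l (ltW (K0 delta0)) (rate _ a1).
    rewrite lee_fin /r [(1 + alpha) * (beta / _)]mulrA => /le_trans; apply.
    by rewrite mulrA (mulrC (classifier_const _ _ _ _ _)).
  - apply: measurableT_comp => //.
    exact: (measurable_excess (D := (m + k).-tuple ('rV[R]_d * bool)) pb0 mghat').
  - move=> D; rewrite lee_fin; apply: (excess_ge0 reg) => //.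
    exact: (measurableT_comp mghat' (pair1_measurable D)).
pose thetahat (z : (m + k).-tuple ('rV[R]_d * bool) * N.-tuple 'rV[R]_d) :=
  theta_hat p etahat z.1.
have mthetahat : threshold_estimator thetahat.
  exact: (measurableT_comp mth measurable_fst).
apply: (@le_trans _ _ (ereal_sup [set threshold_risk P thetahat |
  P in P_Sigma d alpha C0 delta0 p beta L c0 r0 mumin mumax])).
  by apply: ereal_inf_lbound; exists thetahat.
apply: ge_ereal_sup => _ [P /tailP[eta [reg pb _ tl]] <-].
rewrite /threshold_risk (@integral_sample_law_fst _ _ _ N P (fun D =>
  (`|theta_star P - theta_hat p etahat D|)%:E)).
- have := theta_hat_moment reg hp pb s0 hC1 hC2 k0 ks metahat tl (lexx 1).
  under eq_integral do rewrite powRr1// distrC.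
  move=> /le_trans; apply.
  have := ler_wpM2l (ltW (T0 _ ltr01)) (rate _ ltr01).
  rewrite lee_fin mul1r !powRr1 ?(ltW s0)// => /le_trans; apply.
  by rewrite mulrA (mulrC (threshold_const _ _ _ _)).
- by apply: measurableT_comp => //; apply: measurableT_comp => //; exact: measurable_funB.
- by move=> D; rewrite lee_fin.
Qed.
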